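(* Let $k$ be a positive integer and $\alpha_0,\alpha_1,\dots,\alpha_{k-1}\in\omega_1\setminus\{0\}$. Then \[P^{top}(\omega^{\alpha_0},\omega^{\alpha_1},\dots,\omega^{\alpha_{k-1}})=\omega^{\alpha_0\odot\alpha_1\odot\cdots\odot\alpha_{k-1}}.\]
   Context: Ordinals carry the order topology, subsets the subspace topology; arithmetic is ordinal arithmetic. $P^{top}(\alpha_0,\dots,\alpha_{k-1})$ is the least ordinal $\beta$ such that for every $c:\beta\to\{0,\dots,k-1\}$ there exist $i$ and $X\subseteq c^{-1}(\{i\})$ homeomorphic to $\alpha_i$. The natural sum $\alpha\#\beta$: write $\alpha=\sum_j\omega^{\gamma_j}l_j$, $\beta=\sum_j\omega^{\gamma_j}m_j$ with common decreasing exponents and $l_j,m_j\in\omega$; then $\alpha\#\beta=\sum_j\omega^{\gamma_j}(l_j+m_j)$. The Milner–Rado sum $\alpha_0\odot\cdots\odot\alpha_{k-1}$ is the least ordinal $\delta$ such that $\delta\neq\widetilde\alpha_0\#\cdots\#\widetilde\alpha_{k-1}$ whenever $\widetilde\alpha_i<\alpha_i$ for all $i$. *)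

(* Defs.v *)
From HB Require Import structures.
From mathcomp Require Import all_boot all_order all_algebra.
From mathcomp Require Import generic_quotient wochoice.
From mathcomp Require Import all_classical all_reals all_analysis.

Set Implicit Arguments.
Unset Strict Implicit.
Unset Printing Implicit Defensive.
Set SsrOldRewriteGoalsOrder.

Import Order.TTheory.
Local Open Scope classical_set_scope.
Local Open Scope order_scope.

(* The ordinals are the ranks of well-founded trees: [Sup f] stands for the
   least ordinal that is strictly above every [f a].  Trees of the same rank
   are identified in [Ord] below.  See [ord_wf], [Ord_strict_sup] and
   [well_order_type] for the well-ordering of [Ord], the existence of suprema
   and the fact that [Ord] contains the type of every well-order. *)
Inductive otree : Type := Sup (A : Type) (f : A -> otree).

Fixpoint tle (s t : otree) : Prop :=
  match s, t with Sup A f, Sup B g => forall a, exists b, tle (f a) (g b) end.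

Definition tlt (s t : otree) : Prop :=
  match t with Sup B g => exists b, tle s (g b) end.

Lemma tle_refl s : tle s s.
Proof. by elim: s => A f IH /= a; exists a. Qed.

Lemma tle_trans s t u : tle s t -> tle t u -> tle s u.
Proof.
elim: s t u => A f IH [B g] [C h] /= fg gh a.
have [b fagb] := fg a; have [c gbhc] := gh b.
by exists c; exact: IH gbhc.
Qed.

Lemma tle_or_tlt s t : tle s t \/ tlt t s.
Proof.
elim: s t => A f IH [B g] /=.
have [|/existsNP[a /forallNP fag]] :=
  pselect (forall a, exists b, tle (f a) (g b)); first by left.
right; exists a.
have gfa b : tlt (g b) (f a) by case: (IH a (g b)) => // /fag.
by case: (f a) gfa.
Qed.

Lemma tltW s t : tlt s t -> tle s t.
Proof.
suff child (A : Type) (f : A -> otree) a : tle (f a) (Sup f).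
  by case: t => A f [a sfa]; exact: tle_trans sfa (child A f a).
move: (erefl (f a)); move: {-2}(f a) => u; elim: u A f a => B g IH A f a E.
move=> b; exists a; rewrite -E; exact: IH (erefl (g b)).
Qed.

Lemma tle_tlt_trans s t u : tle s t -> tlt t u -> tlt s u.
Proof. by case: u => C h /= st [c tc]; exists c; exact: tle_trans tc. Qed.

Lemma tlt_tle_trans s t u : tlt s t -> tle t u -> tlt s u.
Proof.
case: t u => B g [C h] /= [b sb] /(_ b)[c bc].
by exists c; exact: tle_trans bc.
Qed.

Lemma tlt_irr t : ~ tlt t t.
Proof.
elim: t => B g IH [b gb]; apply: (IH b).
by apply: tlt_tle_trans gb; exists b; exact: tle_refl.
Qed.

Lemma tlt_nle s t : tlt s t <-> ~ tle t s.
Proof.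
split=> [st ts|nts]; last by case: (tle_or_tlt t s).
by apply: (@tlt_irr s); exact: tlt_tle_trans ts.
Qed.

Lemma tlt_wf : well_founded tlt.
Proof.
have below t : forall s, tle s t -> Acc tlt s.
  elim: t => B g IH s sg; constructor=> u us.
  by have [b ub] := tlt_tle_trans us sg; exact: IH ub.
by move=> t; exact: below (tle_refl t).
Qed.

HB.instance Definition _ := gen_eqMixin otree.
HB.instance Definition _ := gen_choiceMixin otree.

Definition same_rank (s t : otree) : bool := `[< tle s t /\ tle t s >].

Lemma same_rank_refl : reflexive same_rank.
Proof. by move=> s; apply/asboolP; split; exact: tle_refl. Qed.

Lemma same_rank_sym : symmetric same_rank.
Proof. by move=> s t; apply/asboolP/asboolP => -[]. Qed.

Lemma same_rank_trans : transitive same_rank.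
Proof.
move=> t s u /asboolP[st ts] /asboolP[tu ut]; apply/asboolP.
by split; [exact: tle_trans tu|exact: tle_trans ts].
Qed.

Canonical same_rank_equiv :=
  EquivRel same_rank same_rank_refl same_rank_sym same_rank_trans.

Definition Ord : Type := {eq_quot same_rank}%qT.
HB.instance Definition _ := Choice.on Ord.

Definition rank (t : otree) : Ord := (\pi_({eq_quot same_rank}) t)%qT.
Definition tree_of (a : Ord) : otree := repr (a : {eq_quot same_rank}%qT).

Lemma tree_ofK : cancel tree_of rank.
Proof. by move=> a; rewrite /rank /tree_of reprK. Qed.

Lemma rank_eq s t : rank s = rank t <-> tle s t /\ tle t s.
Proof.
split=> [st|st]; last by apply/eqmodP/asboolP.
by apply/asboolP; move/eqmodP: st.
Qed.

Lemma tree_rank t : tle (tree_of (rank t)) t /\ tle t (tree_of (rank t)).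
Proof. by apply/rank_eq; rewrite tree_ofK. Qed.

Definition ole (a b : Ord) : bool := `[< tle (tree_of a) (tree_of b) >].

Lemma ole_refl : reflexive ole.
Proof. by move=> a; apply/asboolP; exact: tle_refl. Qed.

Lemma ole_anti : antisymmetric ole.
Proof.
move=> a b /andP[/asboolP ab /asboolP ba].
by rewrite -[a]tree_ofK -[b]tree_ofK; apply/rank_eq.
Qed.

Lemma ole_trans : transitive ole.
Proof.
by move=> b a c /asboolP ab /asboolP bc; apply/asboolP; exact: tle_trans bc.
Qed.

Lemma ole_total : total ole.
Proof.
move=> a b; apply/orP; have [ab|ba] := tle_or_tlt (tree_of a) (tree_of b).
  by left; apply/asboolP.
by right; apply/asboolP; exact: tltW.
Qed.

Fact ord_display : Order.disp_t. Proof. exact: Order.Disp tt tt. Qed.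
HB.instance Definition _ :=
  Order.Le_isPOrder.Build ord_display Ord ole_refl ole_anti ole_trans.
HB.instance Definition _ := Order.POrder_isTotal.Build ord_display Ord ole_total.

Lemma oleE (a b : Ord) : a <= b <-> tle (tree_of a) (tree_of b).
Proof. by split => [/asboolP|?]; last exact/asboolP. Qed.

Lemma oltE (a b : Ord) : a < b <-> tlt (tree_of a) (tree_of b).
Proof.
rewrite ltNge; split=> [/negP ba|/tlt_nle ab].
  by apply/tlt_nle => /oleE.
by apply/negP => /oleE.
Qed.

Lemma ord_wf : well_founded (fun a b : Ord => a < b).
Proof.
suff acc t : forall a, tree_of a = t -> Acc (fun a b : Ord => a < b) a.
  by move=> a; exact: acc (erefl _).
elim: (tlt_wf t) => {}t _ IH a at_; constructor=> b /oltE.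
by rewrite at_ => bt; exact: (IH _ bt b (erefl _)).
Qed.

Lemma Ord_strict_sup (A : Type) (f : A -> Ord) :
  exists b : Ord, forall c, b <= c <-> (forall a, f a < c).
Proof.
exists (rank (Sup (tree_of \o f))) => c.
have [sr rs] := tree_rank (Sup (tree_of \o f)).
split=> [/oleE bc a|fc].
  apply/oltE; apply: tlt_tle_trans (tle_trans rs bc).
  by exists a; exact: tle_refl.
apply/oleE; apply: tle_trans sr _.
case E: (tree_of c) => [B g] a /=.
by have /oltE := fc a; rewrite E.
Qed.

Lemma well_order_type (A : Type) (R : A -> A -> Prop) :
    well_founded R -> (forall x y z, R x y -> R y z -> R x z) ->
    (forall x y, R x y \/ x = y \/ R y x) ->
  exists (a : Ord) (f : A -> Ord),
    (forall x y, R x y <-> f x < f y) /\ range f = [set b | b < a].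
Proof.
move=> wfR trR totR.
pose step x (rec : forall y, R y x -> Ord) : Ord :=
  projT1 (cid (Ord_strict_sup (fun u : {y | R y x} => rec (sval u) (svalP u)))).
pose f := Fix wfR (fun=> Ord) step.
have fE x c : f x <= c <-> forall y, R y x -> f y < c.
  rewrite /f Fix_eq; last first.
    move=> {}x g h gh; congr step; apply: functional_extensionality_dep => y.
    exact: functional_extensionality_dep.
  rewrite {1}/step; case: cid => /= b ->; split=> [H y yx|H [y yx]] /=.
    exact: (H (exist _ y yx)).
  exact: H.
have fR x y : R x y -> f x < f y by move=> xy; exact: (iffLR (fE y _) (lexx _)).
have fRE x y : R x y <-> f x < f y.
  split; first exact: fR.
  case: (totR x y) => [//|[->|/fR yx xy]]; first by rewrite ltxx.
  by have := lt_trans xy yx; rewrite ltxx.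
have [a aP] := Ord_strict_sup f.
exists a, f; split => //; apply/seteqP; split=> [_ [x _ <-]|b /= ba].
  exact: (iffLR (aP a) (lexx _)).
apply: contrapT => nb.
have nbf x : f x <> b by move=> fb; apply: nb; exists x.
suff : a <= b by rewrite leNgt ba.
apply/aP; apply: (well_founded_ind wfR) => x IH.
by rewrite lt_neqAle; apply/andP; split; [exact/eqP|exact/fE].
Qed.

Definition ozero : Ord := rank (Sup (fun a : void => of_void _ a)).

Lemma ozero_le (a : Ord) : ozero <= a.
Proof.
apply/oleE; have [+ _] := tree_rank (Sup (fun a : void => of_void _ a)).
by move/tle_trans; apply; case: (tree_of a) => A f [].
Qed.

(* The least element of [P]; [ozero] if [P] is empty. *)
Definition least (P : set Ord) : Ord := xget ozero [set a | P a /\ lbound P a].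

Lemma leastP (P : set Ord) :
  P !=set0 -> P (least P) /\ forall b, P b -> least P <= b.
Proof.
move=> [a Pa]; suff : exists a, P a /\ lbound P a by exact: xgetPex.
elim: (ord_wf a) Pa => {}a _ IH Pa.
have [[b [ba Pb]]|nb] := pselect (exists b, b < a /\ P b); first exact: IH Pb.
exists a; split=> // b Pb; rewrite leNgt; apply/negP => ba.
by apply: nb; exists b.
Qed.

Definition osucc (a : Ord) : Ord := least [set b | a < b].

Definition osup (P : set Ord) : Ord := least (ubound P).

Definition is_limit (a : Ord) : Prop := a <> ozero /\ forall b, a <> osucc b.

Lemma osuccP (a b : Ord) : osucc a <= b <-> a < b.
Proof.
have : [set b | a < b] !=set0.
  have [c cP] := Ord_strict_sup (fun _ : unit => a).
  by exists c; exact: (iffLR (cP c) (lexx _) tt).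
move=> /leastP[a1 a2]; split=> [|/a2//]; exact: lt_le_trans.
Qed.

Lemma lt_osucc (a : Ord) : a < osucc a.
Proof. by apply/osuccP. Qed.

Lemma osucc_inj : injective osucc.
Proof.
have le_of (a b : Ord) : osucc a = osucc b -> a <= b.
  move=> ab; rewrite leNgt; apply/negP => /osuccP; rewrite -ab.
  by rewrite leNgt lt_osucc.
by move=> a b ab; apply/le_anti/andP; split; exact: le_of.
Qed.

(* Transfinite recursion: value [z] at [ozero], [s] at successors, suprema of
   the previous values at limits; see [ord_rec_zero], [ord_rec_succ], [ord_rec_lim]. *)
Definition ord_rec_step (z : Ord) (s : Ord -> Ord) (b : Ord)
    (rec : forall c, c < b -> Ord) : Ord :=
  if b == ozero then z
  else if pselect (exists c, osucc c = b) is left succ_b then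
    let: exist c cb := cid succ_b in
    s (rec c (eq_ind _ (fun b => c < b) (lt_osucc c) _ cb))
  else osup [set d | exists c, exists cb : c < b, d = rec c cb].

Definition ord_rec (z : Ord) (s : Ord -> Ord) : Ord -> Ord :=
  Fix ord_wf (fun=> Ord) (ord_rec_step z s).

Lemma ord_recE z s b : ord_rec z s b = @ord_rec_step z s b (fun c _ => ord_rec z s c).
Proof.
rewrite /ord_rec Fix_eq // => {}b g h gh; congr (@ord_rec_step z s b).
apply: functional_extensionality_dep => c.
exact: functional_extensionality_dep.
Qed.

Lemma ord_rec_zero z s : ord_rec z s ozero = z.
Proof. by rewrite ord_recE /ord_rec_step eqxx. Qed.

Lemma ord_rec_succ z s b : ord_rec z s (osucc b) = s (ord_rec z s b).
Proof.
rewrite ord_recE /ord_rec_step ifF; last first.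
  by apply/eqP => b0; have := lt_osucc b; rewrite b0 ltNge ozero_le.
case: pselect => [?|[]]; last by exists b.
by case: cid => c /= /osucc_inj ->.
Qed.

Lemma ord_rec_lim z s b : is_limit b ->
  ord_rec z s b = osup (ord_rec z s @` [set c | c < b]).
Proof.
move=> [/eqP b0 nS]; rewrite ord_recE /ord_rec_step (negbTE b0).
case: pselect => [[c cb]|_]; first by case: (nS c).
congr osup; apply/seteqP; split=> [_ [c [cb ->]]|_ [c cb <-]].
  by exists c.
by exists c, cb.
Qed.

Definition oadd (a b : Ord) : Ord := ord_rec a osucc b.
Definition omul (a b : Ord) : Ord := ord_rec ozero (fun c => oadd c a) b.
Definition opow (a b : Ord) : Ord := ord_rec (osucc ozero) (fun c => omul c a) b.

Definition ofnat (n : nat) : Ord := iter n osucc ozero.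
Definition omega : Ord := osup (range ofnat).
Definition omega1 : Ord := least [set a | ~ countable [set b | b < a]].

Lemma uncountable_segment : exists a : Ord, ~ countable [set b | b < a].
Proof.
pose T : eqType := {classic (nat -> bool)}.
have [R woR] := @well_ordering_principle T.
have minR (P : pred T) x : P x -> exists2 z, P z & forall y, P y -> R z y.
  move=> Px; have [|z [[Pz zP] _]] := woR [pred y | P y]; first by exists x.
  by exists z => // y; exact: zP.
have totR x y : R x y \/ R y x.
  have [|z zxy zP] := minR (fun u => (u == x) || (u == y)) x.
    by rewrite eqxx.
  by case/orP: zxy => /eqP zE; [left|right]; rewrite -{1}zE zP ?eqxx ?orbT.
have reflR x : R x x by case: (totR x x).
have antiR x y : R x y -> R y x -> x = y.
  move=> xy yx; have [|z [_ zP]] := woR [pred u | (u == x) || (u == y)].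
    by exists x; rewrite inE eqxx.
  rewrite -(zP x); first apply/zP.
    split=> [|u]; rewrite inE ?eqxx ?orbT // => /orP[] /eqP -> //.
  by split=> [|u]; rewrite inE ?eqxx // => /orP[] /eqP ->.
have trR x y z : R x y -> R y z -> R x z.
  move=> xy yz.
  have [|w wxyz wP] := minR (fun u => [|| u == x, u == y | u == z]) x.
    by rewrite eqxx.
  have wx : R w x by apply: wP; rewrite eqxx.
  have wy : R w y by apply: wP; rewrite eqxx orbT.
  have wz : R w z by apply: wP; rewrite eqxx !orbT.
  case/or3P: wxyz => /eqP wE; rewrite -> wE in *.
  - by [].
  - by rewrite (antiR _ _ xy wx).
  - by rewrite -(antiR _ _ yz wy).
pose S (x y : nat -> bool) := R x y /\ x <> y.
have [||| a [f [fS fa]]] := @well_order_type (nat -> bool) S.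
- move=> x; apply: contrapT => nx.
  have [|z /asboolP nz zP] := minR (fun u => `[< ~ Acc S u >]) x.
    exact/asboolP.
  apply: nz; constructor=> y [yz neq]; apply: contrapT => ny.
  by apply: neq; apply: antiR => //; apply: zP; exact/asboolP.
- move=> x y z [xy nxy] [yz nyz]; split; first exact: trR yz.
  by move=> xz; apply: nyz; apply: antiR => //; rewrite -xz.
- move=> x y; have [|nxy] := pselect (x = y); first by right; left.
  have [|] := totR x y; first by left.
  by move=> yx; right; right; split=> // ?; apply: nxy.
exists a; rewrite -fa => /countable_injP[g g_inj].
have f_inj : injective f.
  move=> x y fxy; apply: contrapT => nxy; have [xy|yx] := totR x y.
    by have /fS := conj xy nxy : S x y; rewrite fxy ltxx.
  by have /fS := conj yx (nxy \o esym) : S y x; rewrite fxy ltxx.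
pose h x := g (f x).
have h_inj : injective h.
  move=> x y /g_inj E; apply/f_inj/E; apply: mem_set; [by exists x|by exists y].
pose d : nat -> bool := fun n => `[< exists x : nat -> bool, h x = n /\ ~~ x n >].
have [dd|dd] := boolP (d (h d)).
  by have /asboolP[x [/h_inj -> ]] := dd; rewrite dd.
by have /asboolP := dd; apply; exists d.
Qed.

Lemma omega1P (a : Ord) : a < omega1 <-> countable [set b | b < a].
Proof.
have [w1 w1_min] := leastP uncountable_segment.
split=> [aw|ca]; first by apply: contrapT => /w1_min; rewrite leNgt aw.
rewrite ltNge; apply/negP => wa; apply: w1; apply: sub_countable ca.
by apply: subset_card_le => b /= bw; exact: lt_le_trans wa.
Qed.

Definition natural_sum_spec (a b c : Ord) : Prop :=
  exists (n : nat) (g : 'I_n -> Ord) (l m : 'I_n -> nat),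
    [/\ forall i j : 'I_n, (i < j)%N -> g j < g i,
        a = \big[oadd/ozero]_(j < n) omul (opow omega (g j)) (ofnat (l j)),
        b = \big[oadd/ozero]_(j < n) omul (opow omega (g j)) (ofnat (m j)) &
        c = \big[oadd/ozero]_(j < n) omul (opow omega (g j)) (ofnat (l j + m j)%N)].

(* Every two ordinals have common Cantor normal forms, so the default value
   of [xget] is never used. *)
Definition natural_sum (a b : Ord) : Ord :=
  xget ozero [set c | natural_sum_spec a b c].

Definition milner_rado_sum (k : nat) (alpha : 'I_k -> Ord) : Ord :=
  least [set d | forall a : 'I_k -> Ord, (forall i, a i < alpha i) ->
    d <> \big[natural_sum/ozero]_(i < k) a i].

(* The ordinal [b] as the set of its predecessors, with the order topology. *)
Definition below (b : Ord) : Type := {a : Ord | a < b}.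
HB.instance Definition _ b := SubChoice.on (below b).
Fact below_display : Order.disp_t. Proof. exact: Order.Disp tt tt. Qed.
HB.instance Definition _ b :=
  [SubChoice_isSubOrder of below b by <: with below_display].
HB.instance Definition _ b :=
  Topological.copy (below b) (order_topology (below b)).
HB.instance Definition _ b :=
  Order_isNbhs.Build below_display (below b) order_nbhs_itv.

Definition homeomorphic (T U : topologicalType) : Prop :=
  exists (f : T -> U) (g : U -> T),
    [/\ cancel f g, cancel g f, continuous f & continuous g].

(* [X], coerced to a type, carries the subspace topology.  A nonzero value of
   [Ptop] entails that some [b] has the partition property, since [least] is
   [ozero] on the empty set. *)
Definition Ptop (k : nat) (alpha : 'I_k -> Ord) : Ord :=
  least [set b | forall c : below b -> 'I_k,
    exists (i : 'I_k) (X : set (below b)),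
      X `<=` c @^-1` [set i] /\ homeomorphic X (below (alpha i))].

(* Main.v *)
(* Let [rk C x] be the Cantor-Bendixson rank of [x] relative to a set [C] of
   ordinals and write [d] for the Milner-Rado sum.

   Upper bound: if [wpow d] is covered by [C_0, .., C_(k-1)], then the rank [d] of
   the end point [wpow d] is at most the natural sum of its ranks relative to the
   [C_i].  The sums of ordinals [a_i < alpha_i] are closed downwards and miss [d],
   so [alpha_i <= rk C_i (wpow d)] for some [i], and [C_i] then contains a copy
   of [wpow alpha_i] converging to [wpow d].

   Lower bound: if [b < wpow d], then all but finitely many points of [b] have
   rank below some [g < d], and [g] is a natural sum of ordinals
   [a_i < alpha_i], hence a union of sets of order types at most [a_i].  Colour
   a point by the part containing its rank.  A copy of [wpow alpha_i] in
   colour [i] would have ranks below [a_i] from some point on. *)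
Require Import Defs.
From mathcomp Require Import all_boot all_order.
From mathcomp Require Import interval all_classical topology.
From Stdlib Require Import Relation_Operators Wellfounded.

Set Implicit Arguments.
Unset Strict Implicit.
Unset Printing Implicit Defensive.

Import Order.TTheory.
Local Open Scope classical_set_scope.
Local Open Scope order_scope.

Implicit Types a b c d x y z : Ord.

(** * Ordinal arithmetic *)

Lemma olt_ind (P : Ord -> Prop) :
  (forall a, (forall b, b < a -> P b) -> P a) -> forall a, P a.
Proof. exact: (well_founded_ind ord_wf). Qed.

Lemma least_eq (P : set Ord) (m : Ord) : P m -> (forall b, P b -> m <= b) -> least P = m.
Proof.
move=> Pm mP; have [Pl lP] := leastP (ex_intro _ m Pm).
by apply/le_anti; rewrite lP //= mP.
Qed.

Lemma osucc_le a b : (osucc a <= b) = (a < b).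
Proof. by apply/idP/idP => /osuccP. Qed.

Lemma lt_osuccE a b : (a < osucc b) = (a <= b).
Proof. by rewrite ltNge osucc_le -leNgt. Qed.

Lemma gt0_neq a : (ozero < a) = (a != ozero).
Proof. by rewrite lt_neqAle ozero_le andbT eq_sym. Qed.

Lemma nlt0 a : (a < ozero) = false.
Proof. by rewrite ltNge ozero_le. Qed.

Lemma le_of_lt a b : (forall x, x < a -> x < b) -> a <= b.
Proof. by move=> H; rewrite leNgt; apply/negP => /H; rewrite ltxx. Qed.

(* An initial segment of [Ord] is too large to index [Ord_strict_sup]; the
   bound is built along a tree of rank [x] instead. *)
Lemma small_bound (F : Ord -> Ord) x : exists b, forall y, y <= x -> F y < b.
Proof.
suff H t : exists b, forall y, y <= rank t -> F y < b.
  by have := H (tree_of x); rewrite tree_ofK.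
elim: t => A f IH.
pose B i := projT1 (cid (IH i)).
have BP i : forall y, y <= rank (f i) -> F y < B i by rewrite /B; case: cid.
have [b bP] := Ord_strict_sup (fun o : option A =>
  if o is Some i then B i else F (rank (Sup f))).
have {}bP := iffLR (bP b) (lexx b).
exists b => y; rewrite le_eqVlt => /orP[/eqP->|]; first exact: (bP None).
move=> /oltE yf; have [rf fr] := tree_rank (Sup f).
have [i yi] := tlt_tle_trans yf rf.
apply: lt_trans (bP (Some i)) => /=; apply: BP; apply/oleE.
by apply: tle_trans yi _; exact: (tree_rank (f i)).2.
Qed.

Lemma osup_le (P : set Ord) c : ubound P !=set0 ->
  osup P <= c <-> forall x, P x -> x <= c.
Proof.
move=> /leastP[u1 u2]; split=> [sc x /u1|H]; last exact: u2.
by move/le_trans; apply.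
Qed.

Lemma osup_image_le (F : Ord -> Ord) b c :
  osup (F @` [set x | x < b]) <= c <-> forall x, x < b -> F x <= c.
Proof.
have [u uP] := small_bound F b.
rewrite osup_le; last by exists u => _ [x /ltW/uP/ltW xb <-].
by split=> [H x xb|H _ [x /H xb <-//]]; apply: H; exists x.
Qed.

Lemma ord_cases a : [\/ a = ozero, exists b, a = osucc b | is_limit a].
Proof.
have [->|/eqP a0] := eqVneq a ozero; first exact: Or31.
have [?|nS] := pselect (exists b, a = osucc b); first exact: Or32.
by apply: Or33; split=> // b ab; apply: nS; exists b.
Qed.

Lemma limit_lt a b : is_limit a -> b < a -> osucc b < a.
Proof.
move=> [_ aS] ba; rewrite lt_neqAle osucc_le ba andbT.
by apply/eqP => /esym/aS.
Qed.

Lemma oaddS a b : oadd a (osucc b) = osucc (oadd a b).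
Proof. exact: ord_rec_succ. Qed.

Lemma oadd0 a : oadd a ozero = a.
Proof. exact: ord_rec_zero. Qed.

(** The sum [oadd a b] is the least ordinal that is at least [a] and strictly above all [oadd a x]
    with [x < b]. This uniform form spares the case split on zero, successor and limit in the later
    inductions. *)
Lemma oadd_leP a b c :
  oadd a b <= c <-> a <= c /\ forall x, x < b -> oadd a x < c.
Proof.
elim/olt_ind: b c => b IH c.
have [->|[d bE]|lb] := ord_cases b.
- by rewrite oadd0; split=> [ac|[]//]; split=> // x; rewrite nlt0.
- rewrite bE oaddS osucc_le; split=> [dc|[_]]; last by apply; rewrite lt_osucc.
  have db : d < b by rewrite bE lt_osucc.
  have [ad dP] := iffLR (IH d db _) (lexx (oadd a d)).
  split=> [|x]; first exact: le_trans (ltW dc).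
  rewrite lt_osuccE le_eqVlt => /orP[/eqP->//|/dP xd]; exact: lt_trans dc.
- rewrite {1}/oadd ord_rec_lim // osup_image_le; split=> [H|[_ H] x /H/ltW//].
  split=> [|x xb].
    have := H ozero; rewrite -/(oadd _ _) oadd0; apply.
    by rewrite gt0_neq; apply/eqP; case: lb.
  by rewrite -osucc_le -oaddS; apply: H; exact: limit_lt.
Qed.

Lemma le_oaddr a b : a <= oadd a b.
Proof. by have [] := iffLR (oadd_leP a b _) (lexx _). Qed.

Lemma olt_add2l a : {mono oadd a : x y / x < y}.
Proof.
have H x y : x < y -> oadd a x < oadd a y.
  by have [_ ] := iffLR (oadd_leP a y _) (lexx _); apply.
move=> x y; apply/idP/idP; last exact: H.
by rewrite !ltNge; apply: contra; rewrite le_eqVlt => /orP[/eqP->|/H/ltW].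
Qed.

Lemma ole_add2l a : {mono oadd a : x y / x <= y}.
Proof. by move=> x y; rewrite !leNgt olt_add2l. Qed.

Lemma le_oaddl a b : b <= oadd a b.
Proof.
elim/olt_ind: b => b IH; apply: le_of_lt => x xb.
by apply: le_lt_trans (IH x xb) _; rewrite olt_add2l.
Qed.

Lemma oadd_sub a b : a <= b -> exists c, b = oadd a c.
Proof.
(* Take the least [c] with [b <= oadd a c]: each smaller [x] has [oadd a x < b], so [oadd_leP] gives
   the other inequality. *)
move=> ab; have [|lb mb] := @leastP [set c | b <= oadd a c].
  by exists b; exact: le_oaddl.
exists (least [set c | b <= oadd a c]); apply/le_anti; rewrite lb /=.
apply/oadd_leP; split=> // x xl; rewrite ltNge; apply/negP => /mb.
by rewrite leNgt xl.
Qed.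

Lemma oaddA : associative oadd.
Proof.
move=> a b c; elim/olt_ind: c => c IH; apply/le_anti/andP; split.
  apply/oadd_leP; split=> [|x]; first by rewrite (le_trans (le_oaddr a b)) ?le_oaddr.
  have [xb _|bx] := ltP x b.
    by apply: lt_le_trans (le_oaddr _ _); rewrite olt_add2l.
  have [y ->] := oadd_sub bx; rewrite olt_add2l => yc.
  by rewrite IH // olt_add2l.
apply/oadd_leP; split=> [|x xc]; first by rewrite ole_add2l le_oaddr.
by rewrite -IH // !olt_add2l.
Qed.

Lemma add0o : left_id ozero oadd.
Proof.
move=> a; elim/olt_ind: a => a IH; apply/le_anti; rewrite le_oaddl andbT.
by apply/oadd_leP; split=> [|x xa]; [exact: ozero_le|rewrite IH].
Qed.

Lemma ole_add2r a a' b : a <= a' -> oadd a b <= oadd a' b.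
Proof.
move=> aa'; elim/olt_ind: b => b IH; apply/oadd_leP; split=> [|x xb].
  exact: le_trans (le_oaddr _ _).
by apply: le_lt_trans (IH x xb) _; rewrite olt_add2l.
Qed.

Lemma ole_add a a' b b' : a <= a' -> b <= b' -> oadd a b <= oadd a' b'.
Proof. by move=> /ole_add2r aa' bb'; apply: le_trans (aa' _) _; rewrite ole_add2l. Qed.

(** Left subtraction; the value is [ozero] when [b <= a]. *)
Definition osub b a := least [set c | b <= oadd a c].

Lemma osubK a b : a <= b -> oadd a (osub b a) = b.
Proof.
move=> /oadd_sub[c ->]; congr oadd; apply: least_eq => [/=|d /=].
  exact: lexx.
by rewrite ole_add2l.
Qed.

(** * Finite multiples and powers of omega *)

Definition omuln (a : Ord) (n : nat) : Ord := omul a (ofnat n).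

Lemma omuln0 a : omuln a 0 = ozero.
Proof. exact: ord_rec_zero. Qed.

Lemma omulnS a n : omuln a n.+1 = oadd (omuln a n) a.
Proof. exact: ord_rec_succ. Qed.

Lemma omuln1 a : omuln a 1 = a.
Proof. by rewrite omulnS omuln0 add0o. Qed.

Lemma omulnD a m n : omuln a (m + n) = oadd (omuln a m) (omuln a n).
Proof.
elim: n => [|n IH]; first by rewrite addn0 omuln0 oadd0.
by rewrite addnS !omulnS IH oaddA.
Qed.

Lemma le_omuln a m n : (m <= n)%N -> omuln a m <= omuln a n.
Proof. by move=> /subnKC <-; rewrite omulnD le_oaddr. Qed.

Lemma le_omul2r a b n : a <= b -> omuln a n <= omuln b n.
Proof.
move=> ab; elim: n => [|n IH]; first by rewrite !omuln0.
by rewrite !omulnS ole_add.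
Qed.

Lemma omuln_div a n x : x < omuln a n ->
  exists q r, [/\ (q < n)%N, r < a & x = oadd (omuln a q) r].
Proof.
elim: n => [|n IH]; first by rewrite omuln0 nlt0.
rewrite omulnS; have [/IH[q [r [qn ra ->]]] _|nx] := ltP x (omuln a n).
  by exists q, r; split=> //; exact: leqW.
by have [r ->] := oadd_sub nx; rewrite olt_add2l => ra; exists n, r.
Qed.

Lemma ofnat_bound : ubound (range ofnat) !=set0.
Proof.
have [b bP] := Ord_strict_sup ofnat.
by exists b => _ [n _ <-]; apply/ltW; exact: (iffLR (bP b) (lexx _)).
Qed.

Lemma omega_le c : omega <= c <-> forall n, ofnat n <= c.
Proof.
rewrite osup_le; last exact: ofnat_bound.
by split=> [H n|H _ [n _ <-]//]; apply: H; exists n.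
Qed.

Lemma ofnat_lt n : ofnat n < omega.
Proof.
apply: lt_le_trans (lt_osucc _) _.
exact: (iffLR (omega_le omega) (lexx _) n.+1).
Qed.

Lemma lt_omega x : x < omega -> exists n, x = ofnat n.
Proof.
move=> xw; have [n] : exists n, x < ofnat n.
  apply: contrapT => nx; move: xw; rewrite ltNge => /negP; apply.
  by apply/omega_le => n; rewrite leNgt; apply/negP => xn; apply: nx; exists n.
elim: n => [|n IH]; first by rewrite nlt0.
by rewrite lt_osuccE le_eqVlt => /orP[/eqP->|//]; exists n.
Qed.

Lemma omega_limit : is_limit omega.
Proof.
split=> [w0|b wb]; first by have := ofnat_lt 0; rewrite w0 ltxx.
have /lt_omega[n bn] : b < omega by rewrite wb lt_osucc.
by have := ofnat_lt n.+1; rewrite wb bn ltxx.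
Qed.

Lemma omul_omega_le a c : omul a omega <= c <-> forall n, omuln a n <= c.
Proof.
rewrite {1}/omul ord_rec_lim; last exact: omega_limit.
rewrite osup_image_le; split=> [H n|H _ /lt_omega[n ->]]; last exact: H.
by apply: H; exact: ofnat_lt.
Qed.

Local Notation wpow := (opow omega).

Lemma wpow0 : wpow ozero = osucc ozero.
Proof. exact: ord_rec_zero. Qed.

Lemma wpowS b : wpow (osucc b) = omul (wpow b) omega.
Proof. exact: ord_rec_succ. Qed.

Lemma wpow_lim b c : is_limit b ->
  wpow b <= c <-> forall x, x < b -> wpow x <= c.
Proof. by move=> lb; rewrite {1}/opow ord_rec_lim // osup_image_le. Qed.

Lemma omuln_wpowS a n : omuln (wpow a) n <= wpow (osucc a).
Proof. by rewrite wpowS; exact: (iffLR (omul_omega_le _ _) (lexx _)). Qed.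

Lemma le_wpow : {homo wpow : a b / a <= b}.
Proof.
move=> a b; elim/olt_ind: b => b IH.
rewrite le_eqVlt => /orP[/eqP->//|ab].
have [b0|[d bE]|lb] := ord_cases b; first by rewrite b0 nlt0 in ab.
  rewrite bE in ab IH *; apply: le_trans (omuln_wpowS d 1).
  by rewrite omuln1; apply: IH; [exact: lt_osucc|rewrite -lt_osuccE].
exact: (iffLR (wpow_lim _ lb) (lexx _)).
Qed.

Lemma wpow_gt0 a : ozero < wpow a.
Proof.
by rewrite -osucc_le -wpow0 le_wpow // ozero_le.
Qed.

Lemma omuln_wpow_lt a b n : a < b -> omuln (wpow a) n < wpow b.
Proof.
rewrite -osucc_le => /le_wpow; apply: lt_le_trans.
apply: lt_le_trans (omuln_wpowS a n.+1).
by rewrite omulnS -{1}[omuln _ n]oadd0 olt_add2l wpow_gt0.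
Qed.

(** Finite multiples of smaller powers are cofinal in [wpow b], both at successor and at limit
    exponents. This replaces arguments about leading terms of Cantor normal forms. *)
Lemma lt_wpowE x b : b != ozero -> x < wpow b ->
  exists a n, a < b /\ x < omuln (wpow a) n.
Proof.
move=> b0 xb; apply: contrapT => H; move: xb; rewrite ltNge => /negP; apply.
have {}H a n : a < b -> omuln (wpow a) n <= x.
  by move=> ab; rewrite leNgt; apply/negP => xa; apply: H; exists a, n.
have [/eqP|[d bE]|lb] := ord_cases b; first by rewrite (negbTE b0).
  rewrite bE wpowS; apply/omul_omega_le => n; apply: H.
  by rewrite bE lt_osucc.
by apply/wpow_lim => // a ab; rewrite -[wpow a]omuln1 H.
Qed.

Lemma lt_wpow : {homo wpow : a b / a < b}.
Proof. by move=> a b /(@omuln_wpow_lt _ _ 1); rewrite omuln1. Qed.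

Lemma le_wpow_id a : a <= wpow a.
Proof.
elim/olt_ind: a => a IH; apply: le_of_lt => x xa.
exact: le_lt_trans (IH x xa) (lt_wpow xa).
Qed.

Lemma lt_wpow2E x y b : b != ozero -> x < wpow b -> y < wpow b ->
  exists a n, [/\ a < b, x < omuln (wpow a) n & y < omuln (wpow a) n].
Proof.
move=> b0 /(lt_wpowE b0)[a [m [ab xm]]] /(lt_wpowE b0)[a' [m' [ab' ym]]].
exists (Order.max a a'), (maxn m m'); split; first by rewrite gt_max ab.
  apply: lt_le_trans xm _; apply: le_trans (le_omuln _ (leq_maxl m m')) _.
  by apply: le_omul2r; apply: le_wpow; rewrite le_max lexx.
apply: lt_le_trans ym _; apply: le_trans (le_omuln _ (leq_maxr m m')) _.
by apply: le_omul2r; apply: le_wpow; rewrite le_max lexx orbT.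
Qed.

(** Additive indecomposability: both summands lie below one multiple [omuln (wpow a) n] with
    [a < b]. *)
Lemma oadd_wpow_lt x y b : x < wpow b -> y < wpow b -> oadd x y < wpow b.
Proof.
have [->|b0] := eqVneq b ozero.
  by rewrite wpow0 !lt_osuccE => xb yb; rewrite -(oadd0 ozero) ole_add.
move=> /(lt_wpow2E b0) H /H[a [n [ab xn yn]]].
apply: lt_trans (omuln_wpow_lt (n + n) ab).
by rewrite omulnD (le_lt_trans (ole_add2r _ (ltW xn))) // olt_add2l.
Qed.

(** * Natural sums *)

(** Here [step] takes a total function. Partial recursive calls are padded with [ozero], which is
    harmless because [step] depends only on predecessors. *)
Lemma wf_rec (T : Type) (R : T -> T -> Prop) (step : T -> (T -> Ord) -> Ord) :
    well_founded R ->
    (forall t f g, (forall u, R u t -> f u = g u) -> step t f = step t g) ->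
  exists F, forall t, F t = step t F.
Proof.
move=> wfR step_eq.
pose ext t (rec : forall u, R u t -> Ord) u :=
  if pselect (R u t) is left ut then rec u ut else ozero.
exists (Fix wfR (fun=> Ord) (fun t rec => step t (ext t rec))) => t.
rewrite Fix_eq => [|{}t f g fg]; apply: step_eq => u ut; rewrite /ext.
  by case: pselect.
by case: pselect => // ?; exact: fg.
Qed.

Lemma olt2_wf : well_founded
  (symprod Ord Ord (fun a b => a < b) (fun a b => a < b)).
Proof. by apply: wf_symprod; exact: ord_wf. Qed.

(* Hessenberg's recursion for the natural sum. *)
Lemma hess_exists : exists h : Ord -> Ord -> Ord, forall a b c,
  h a b <= c <-> (forall x, x < a -> h x b < c) /\ (forall y, y < b -> h a y < c).
Proof.
pose S (p : Ord * Ord) (f : Ord * Ord -> Ord) := [set c |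
  (forall x, x < p.1 -> f (x, p.2) < c) /\ (forall y, y < p.2 -> f (p.1, y) < c)].
have [p f g fg|h hE] := @wf_rec _ _ (fun p f => least (S p f)) olt2_wf.
  congr least; apply/seteqP; case: p fg => a b /= fg.
  split=> c [/= ca cb]; split=> /= [x xa|y yb].
  - by rewrite -fg ?ca //; exact: left_sym.
  - by rewrite -fg ?cb //; exact: right_sym.
  - by rewrite fg ?ca //; exact: left_sym.
  - by rewrite fg ?cb //; exact: right_sym.
exists (fun a b => h (a, b)) => a b c.
have /leastP : S (a, b) h !=set0.
  have [u uP] := small_bound (fun x => h (x, b)) a.
  have [v vP] := small_bound (fun y => h (a, y)) b.
  exists (Order.max u v); split=> /= [x /ltW/uP|y /ltW/vP] xu;
    by rewrite lt_max xu ?orbT.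
rewrite -hE => -[[/= h1 h2] hmin]; split=> [hc|]; last exact: hmin.
by split=> [x /h1|y /h2] /lt_le_trans; apply.
Qed.

Definition hess : Ord -> Ord -> Ord := projT1 (cid hess_exists).

Lemma hess_leP a b c : hess a b <= c <->
  (forall x, x < a -> hess x b < c) /\ (forall y, y < b -> hess a y < c).
Proof. by rewrite /hess; case: cid. Qed.

Lemma hess_ltl a a' b : a < a' -> hess a b < hess a' b.
Proof. by have [+ _] := iffLR (hess_leP a' b _) (lexx _); apply. Qed.

Lemma hess_ltr a b b' : b < b' -> hess a b < hess a b'.
Proof. by have [_ +] := iffLR (hess_leP a b' _) (lexx _); apply. Qed.

Lemma hess_le a a' b b' : a <= a' -> b <= b' -> hess a b <= hess a' b'.
Proof.
rewrite !le_eqVlt => aa' bb'; rewrite -le_eqVlt.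
apply: (@le_trans _ _ (hess a' b)).
  by case/orP: aa' => [/eqP->//|/hess_ltl/ltW].
by case/orP: bb' => [/eqP->//|/hess_ltr/ltW].
Qed.

Lemma hess00 : hess ozero ozero = ozero.
Proof.
apply/le_anti; rewrite ozero_le andbT.
by apply/hess_leP; split=> x; rewrite nlt0.
Qed.

(** Sums of bounded summands are closed downwards. If [d < hess a b], minimality of [hess a b] gives
    [d <= hess x b] with [x < a] or [d <= hess a y] with [y < b], and the induction continues
    there. *)
Lemma hess_onto a b d : d <= hess a b ->
  exists a' b', [/\ a' <= a, b' <= b & d = hess a' b'].
Proof.
elim/olt_ind: a b d => a IHa b; elim/olt_ind: b => b IHb d.
rewrite le_eqVlt => /orP[/eqP->|]; first by exists a, b.
have [/forallNP ua|/existsNP[x]] := pselect (forall x, ~ (x < a /\ d <= hess x b)); last first.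
  move=> /contrapT[xa /(IHa x xa)[a' [b' [a'x b'b ->]]]] _.
  by exists a', b'; split=> //; exact: ltW (le_lt_trans a'x xa).
have [/forallNP ub|/existsNP[y]] := pselect (forall y, ~ (y < b /\ d <= hess a y)); last first.
  move=> /contrapT[yb /(IHb y yb)[a' [b' [a'a b'y ->]]]] _.
  by exists a', b'; split=> //; exact: ltW (le_lt_trans b'y yb).
rewrite ltNge => /negP[]; apply/hess_leP; split=> [x xa|y yb].
  by rewrite ltNge; apply/negP => dx; apply: ua; exists x.
by rewrite ltNge; apply/negP => dy; apply: ub; exists y.
Qed.

(** Lowering one argument lowers its tail or its coefficient. In the second case the sum of the new
    tails is still below [wpow g], by the first hypothesis, and fits into the copy that has become
    free. *)
Lemma hess_oadd g a b l m :
    (forall x y, x < wpow g -> y < wpow g -> hess x y < wpow g) ->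
    a < wpow g -> b < wpow g ->
  hess (oadd (omuln (wpow g) l) a) (oadd (omuln (wpow g) m) b) <=
    oadd (omuln (wpow g) (l + m)) (hess a b).
Proof.
move=> hg.
have div x p r : x < oadd (omuln (wpow g) p) r -> r < wpow g ->
    exists q s, [/\ x = oadd (omuln (wpow g) q) s, s < wpow g &
                    (q < p)%N \/ q = p /\ s < r].
  move=> xr rg; have [|q [s [qp sg xE]]] := @omuln_div (wpow g) p.+1 x.
    by rewrite omulnS; apply: lt_trans xr _; rewrite olt_add2l.
  exists q, s; split=> //; move: qp; rewrite ltnS leq_eqVlt => /orP[/eqP qp|]; last by left.
  by right; split=> //; move: xr; rewrite xE qp olt_add2l.
(* The induction runs on the two values, since a smaller argument has a new coefficient and a new
   tail. *)
move Eu : (oadd _ a) => u; move Ev : (oadd _ b) => v.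
elim/olt_ind: u v l m a b Eu Ev => u IHu v; elim/olt_ind: v => v IHv.
move=> l m a b Eu Ev ag bg; apply/hess_leP; split=> [x xu|y yv].
  have := xu; rewrite -Eu => /div /(_ ag)[q [s [xE sg]]].
  move=> [ql|[ql sa]]; apply: (le_lt_trans (IHu _ xu _ q m s b (esym xE) Ev sg bg)).
    apply: (@lt_le_trans _ _ (omuln (wpow g) (q + m).+1)).
      by rewrite omulnS olt_add2l hg.
    apply: le_trans (le_oaddr _ _); apply: le_omuln.
    by rewrite -addSn leq_add2r.
  by rewrite ql olt_add2l hess_ltl.
have := yv; rewrite -Ev => /div /(_ bg)[q [s [yE sg]]].
move=> [ql|[ql sa]]; apply: (le_lt_trans (IHv _ yv l q a s Eu (esym yE) ag sg)).
  apply: (@lt_le_trans _ _ (omuln (wpow g) (l + q).+1)).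
    by rewrite omulnS olt_add2l hg.
  apply: le_trans (le_oaddr _ _); apply: le_omuln.
  by rewrite -addnS leq_add2l.
by rewrite ql olt_add2l hess_ltr.
Qed.

Lemma hess_wpow_lt g a b : a < wpow g -> b < wpow g -> hess a b < wpow g.
Proof.
elim/olt_ind: g a b => g IH a b.
have [->|g0] := eqVneq g ozero.
  rewrite wpow0 !lt_osuccE => a0 b0; rewrite -hess00; exact: hess_le.
move=> ag /(lt_wpow2E g0 ag)[e [n [eg an bn]]].
apply: le_lt_trans (omuln_wpow_lt (n + n) eg).
apply: le_trans (hess_le (ltW an) (ltW bn)) _.
by have := hess_oadd n n (IH e eg) (wpow_gt0 e) (wpow_gt0 e); rewrite hess00 !oadd0.
Qed.

(* [d] is a disjoint union of two sets of order types at most [a] and [b]. *)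
Definition splits d a b := exists (A : set Ord) (f g : Ord -> Ord),
  [/\ forall x, x < d -> A x -> f x < a,
      forall x, x < d -> ~ A x -> g x < b,
      forall x y, A x -> A y -> x < y -> y < d -> f x < f y &
      forall x y, ~ A x -> ~ A y -> x < y -> y < d -> g x < g y].

(** Cutting an initial segment at one of its points [y] lowers the bound of the part containing [y]
    to the image of [y], so the sum of the bounds drops strictly. *)
Lemma splits_hess d a b : splits d a b -> d <= hess a b.
Proof.
move=> [A [f [g [fa gb fm gm]]]].
suff H x u v : x <= d -> (forall y, y < x -> A y -> f y < u) ->
    (forall y, y < x -> ~ A y -> g y < v) -> x <= hess u v.
  by apply: H => //.
elim/olt_ind: x u v => x IH u v xd fu gv; apply: le_of_lt => y yx.
have yd := lt_le_trans yx xd.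
have [Ay|nAy] := pselect (A y).
  apply: (@le_lt_trans _ _ (hess (f y) v)); last by apply: hess_ltl; exact: fu.
  apply: IH => // [|z zy Az|z zy nAz]; first exact: ltW.
    exact: fm.
  by apply: gv => //; exact: lt_trans yx.
apply: (@le_lt_trans _ _ (hess u (g y))); last by apply: hess_ltr; exact: gv.
apply: IH => // [|z zy Az|z zy nAz]; first exact: ltW.
  by apply: fu => //; exact: lt_trans yx.
exact: gm.
Qed.

Lemma splits_l a : splits a a ozero.
Proof. by exists setT, id, id; split=> // x _ []. Qed.

Lemma splits_r b : splits b ozero b.
Proof. by exists set0, id, id. Qed.

Lemma splits_oadd d d' a a' b b' : splits d a b -> splits d' a' b' ->
  splits (oadd d d') (oadd a a') (oadd b b').
Proof.
move=> [A [f [g [fa gb fm gm]]]] [A' [f' [g' [fa' gb' fm' gm']]]].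
have sub_lt x y : d <= x -> x < y -> osub x d < osub y d.
  by move=> dx xy; rewrite -(olt_add2l d) !osubK // (le_trans dx) // ltW.
have sub_d x : d <= x -> x < oadd d d' -> osub x d < d'.
  by move=> dx; rewrite -{1}(osubK dx) olt_add2l.
exists [set x | if x < d then A x else A' (osub x d)],
  (fun x => if x < d then f x else oadd a (f' (osub x d))),
  (fun x => if x < d then g x else oadd b (g' (osub x d))).
split=> [x|x|x y|x y] /=; case: (ltP x d) => xd.
- by move=> _ /(fa _ xd) /lt_le_trans; apply; exact: le_oaddr.
- by move=> /(sub_d _ xd) xd' ?; rewrite olt_add2l fa'.
- by move=> _ /(gb _ xd) /lt_le_trans; apply; exact: le_oaddr.
- by move=> /(sub_d _ xd) xd' ?; rewrite olt_add2l gb'.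
- case: (ltP y d) => yd Ax Ay xy _; first exact: fm.
  by apply: lt_le_trans (le_oaddr _ _); exact: fa.
- move=> Ax; case: (ltP y d) => yd Ay xy yd'.
    by have := le_lt_trans xd (lt_trans xy yd); rewrite ltxx.
  by rewrite olt_add2l fm' ?sub_lt ?sub_d.
- case: (ltP y d) => yd Ax Ay xy _; first exact: gm.
  by apply: lt_le_trans (le_oaddr _ _); exact: gb.
- move=> Ax; case: (ltP y d) => yd Ay xy yd'.
    by have := le_lt_trans xd (lt_trans xy yd); rewrite ltxx.
  by rewrite olt_add2l gm' ?sub_lt ?sub_d.
Qed.

(** Of the [l + m] copies of each power, the first [l] go to [a] and the last [m] to [b]. *)
Lemma spec_splits a b c : natural_sum_spec a b c -> splits c a b.
Proof.
move=> [n [g [l [m [_ -> -> ->]]]]].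
elim: n g l m => [|n IH] g l m; first by rewrite !big_ord0; exact: splits_l.
rewrite !big_ord_recl; apply: splits_oadd; last exact: IH.
rewrite -/(omuln _ _) omulnD -[X in splits _ X]oadd0 -[X in splits _ _ X]add0o.
by apply: splits_oadd; [exact: splits_l|exact: splits_r].
Qed.

Lemma cnf_lt n (g : 'I_n -> Ord) (l : 'I_n -> nat) e :
  (forall j, g j < e) ->
  \big[oadd/ozero]_(j < n) omul (wpow (g j)) (ofnat (l j)) < wpow e.
Proof.
move=> ge; apply: (big_ind (fun x => x < wpow e)) => [|x y|j _]; first exact: wpow_gt0.
  exact: oadd_wpow_lt.
exact: omuln_wpow_lt.
Qed.

(** The splitting of [c] gives one inequality; adding the normal forms term by term with [hess_oadd]
    gives the other. *)
Lemma spec_hess a b c : natural_sum_spec a b c -> c = hess a b.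
Proof.
move=> sp; apply/le_anti; rewrite (splits_hess (spec_splits sp)) /=.
case: sp => n [g [l [m [+ -> -> ->]]]] {a b c}.
elim: n g l m => [|n IH] g l m gd; first by rewrite !big_ord0 hess00.
rewrite !big_ord_recl; set a := \big[_/_]_(i < n) _ _ (_ (l _)).
set b := \big[_/_]_(i < n) _ _ (_ (m _)).
apply: le_trans (hess_oadd _ _ _ _ _) _.
- by move=> x y; exact: hess_wpow_lt.
- by apply: cnf_lt => j; apply: gd.
- by apply: cnf_lt => j; apply: gd.
- by rewrite ole_add2l; apply: IH => i j ij; apply: gd.
Qed.

Lemma spec_exists a b : exists c, natural_sum_spec a b c.
Proof.
suff H g : a < wpow g -> b < wpow g ->
    exists (n : nat) (G : 'I_n -> Ord) (l m : 'I_n -> nat),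
    [/\ forall i j : 'I_n, (i < j)%N -> G j < G i, forall j, G j < g,
        a = \big[oadd/ozero]_(j < n) omul (opow omega (G j)) (ofnat (l j)) &
        b = \big[oadd/ozero]_(j < n) omul (opow omega (G j)) (ofnat (m j))].
  (* This exponent is large enough because every ordinal [x] satisfies [x <= wpow x]. *)
  have [||n [G [l [m [Gd _ aE bE]]]]] := H (osucc (Order.max a b)).
  - apply: le_lt_trans (le_wpow_id a) _; apply: lt_wpow.
    by rewrite lt_osuccE le_max lexx.
  - apply: le_lt_trans (le_wpow_id b) _; apply: lt_wpow.
    by rewrite lt_osuccE le_max lexx orbT.
  - by eexists; exists n, G, l, m.
elim/olt_ind: g a b => g IH a b.
have [->|g0] := eqVneq g ozero.
  rewrite wpow0 !lt_osuccE => a0 b0; exists 0%N, (fun=> ozero), (fun=> 0%N), (fun=> 0%N).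
  split=> [[]//|[]//||]; rewrite big_ord0; apply/le_anti; rewrite ozero_le andbT //.
(* Both ordinals are divided by a common power; a quotient may be zero, as the coefficients may. *)
move=> ag /(lt_wpow2E g0 ag)[e [p [eg /omuln_div[q [r [_ re ->]]] /omuln_div[q' [r' [_ re' ->]]]]]].
have [n [G [l [m [Gd Ge rE rE']]]]] := IH e eg r r' re re'.
pose cons T (t : T) (u : 'I_n -> T) (i : 'I_n.+1) :=
  if unlift ord0 i is Some j then u j else t.
have cons0 T (t : T) u : cons T t u ord0 = t by rewrite /cons unlift_none.
have consS T (t : T) u j : cons T t u (lift ord0 j) = u j by rewrite /cons liftK.
exists n.+1, (cons _ e G), (cons _ q l), (cons _ q' m); split.
- move=> i j; case: (unliftP ord0 i) => [i'|] ->; case: (unliftP ord0 j) => [j'|] -> //.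
    by rewrite !consS => ij; exact: Gd.
  by rewrite cons0 consS.
- move=> j; case: (unliftP ord0 j) => [j'|] ->; last by rewrite cons0.
  by rewrite consS; exact: lt_trans eg.
- rewrite big_ord_recl !cons0 rE; congr oadd.
  by apply: eq_bigr => j _; rewrite !consS.
- rewrite big_ord_recl !cons0 rE'; congr oadd.
  by apply: eq_bigr => j _; rewrite !consS.
Qed.

Lemma natural_sumE a b : natural_sum a b = hess a b.
Proof.
by have [c sp] := spec_exists a b; apply: spec_hess; exact: xgetPex (ex_intro _ c sp).
Qed.

Lemma natural_sum_splits a b : splits (natural_sum a b) a b.
Proof.
by have [c sp] := spec_exists a b; apply: spec_splits; exact: xgetPex (ex_intro _ c sp).
Qed.

Lemma natural_sum_le a a' b b' : a <= a' -> b <= b' ->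
  natural_sum a b <= natural_sum a' b'.
Proof. by rewrite !natural_sumE; exact: hess_le. Qed.

Lemma big_natural_sum_le k (a b : 'I_k -> Ord) : (forall i, a i <= b i) ->
  \big[natural_sum/ozero]_(i < k) a i <= \big[natural_sum/ozero]_(i < k) b i.
Proof.
by move=> ab; apply: (big_ind2 (fun x y => x <= y)) => // *; exact: natural_sum_le.
Qed.

Lemma big_natural_sum_lt k (a b : 'I_k -> Ord) :
    (forall i, a i <= b i) -> (exists i, a i < b i) ->
  \big[natural_sum/ozero]_(i < k) a i < \big[natural_sum/ozero]_(i < k) b i.
Proof.
elim: k a b => [|k IH] a b ab [i]; first by case: i.
rewrite !big_ord_recl !natural_sumE.
case: (unliftP ord0 i) => [j|] -> lt_i.
  apply: lt_le_trans (hess_le (ab ord0) (lexx _)).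
  by apply: hess_ltr; apply: IH => //; exists j.
apply: le_lt_trans (hess_ltl _ lt_i); apply: hess_le => //.
exact: big_natural_sum_le.
Qed.

Lemma big_natural_sum_onto k (b : 'I_k -> Ord) d :
  d <= \big[natural_sum/ozero]_(i < k) b i ->
  exists a : 'I_k -> Ord, (forall i, a i <= b i) /\ d = \big[natural_sum/ozero]_(i < k) a i.
Proof.
elim: k b d => [|k IH] b d.
  rewrite big_ord0 => d0; exists b; split=> //; rewrite big_ord0.
  by apply/le_anti; rewrite d0 ozero_le.
rewrite big_ord_recl natural_sumE => /hess_onto[a0 [s [ab sb ->]]].
have [a [aS ->]] := IH _ _ sb.
exists (fun i => if unlift ord0 i is Some j then a j else a0); split=> [i|].
  by case: (unliftP ord0 i) => [j|] ->; rewrite ?liftK ?unlift_none.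
rewrite big_ord_recl unlift_none natural_sumE; congr hess.
by apply: eq_bigr => j _; rewrite liftK.
Qed.

(** Iterated two-part splitting. Each [s i] is strictly increasing on [C i] and so bounds its order
    type by [a i]. *)
Lemma big_natural_sum_splits k (a : 'I_k -> Ord) :
  let d := \big[natural_sum/ozero]_(i < k) a i in
  exists (C : 'I_k -> set Ord) (s : 'I_k -> Ord -> Ord),
  [/\ forall x, x < d -> exists i, C i x,
      forall i x, C i x -> x < d -> s i x < a i &
      forall i x y, C i x -> C i y -> x < y -> y < d -> s i x < s i y].
Proof.
elim: k a => [|k IH] a /=.
  rewrite big_ord0; exists (fun=> set0), (fun=> id).
  by split=> // x; rewrite nlt0.
rewrite big_ord_recl; set d' := \big[_/_]_(i < k) _.
have [A [f [g [fa gd fm gm]]]] := natural_sum_splits (a ord0) d'.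
have [C [s [Cd sa sm]]] := IH (fun j => a (lift ord0 j)).
exists (fun i => if unlift ord0 i is Some j then [set x | ~ A x /\ C j (g x)] else A).
exists (fun i => if unlift ord0 i is Some j then s j \o g else f).
split=> [x xd|i x|i x y].
- have [Ax|nAx] := pselect (A x); first by exists ord0; rewrite unlift_none.
  by have [j Cj] := Cd _ (gd _ xd nAx); exists (lift ord0 j); rewrite liftK.
- case: (unliftP ord0 i) => [j|] ->; rewrite ?liftK ?unlift_none.
    by move=> [nA Cx] xd; apply: sa => //; exact: gd.
  by move=> Ax /fa; apply.
- case: (unliftP ord0 i) => [j|] _; last exact: fm.
  move=> [nA Cx] [nA' Cy] xy yd /=; apply: sm => //; first exact: gm.
  exact: gd.
Qed.

(** * Cantor-Bendixson ranks *)

(** [P] holds on some interval that ends just before [x]. The case [x = ozero] is vacuous and admits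
    any [w]. *)
Definition near_below x (P : set Ord) :=
  exists w, (w < x \/ x = ozero) /\ forall y, w < y -> y < x -> P y.

(** The rank of [x] is the least strict bound for the ranks of the points of [C] just below [x].
    Points above [x] do not matter, since the ordinals up to [x] form a neighbourhood of [x]. *)
Lemma rk_exists (C : set Ord) : exists r : Ord -> Ord, forall x z,
  r x <= z <-> near_below x (fun y => C y -> r y < z).
Proof.
pose S x (f : Ord -> Ord) := [set z | near_below x (fun y => C y -> f y < z)].
have [x f g fg|r rE] := @wf_rec _ _ (fun x f => least (S x f)) ord_wf.
  congr least; apply/seteqP; split=> z [w [wx H]]; exists w; split=> // y wy yx Cy.
    by rewrite -fg // H.
  by rewrite fg // H.
exists r => x z; have /leastP : S x r !=set0.
  have [b bP] := small_bound r x; exists b, ozero; split=> [|y _ /ltW/bP//].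
  by have [->|x0] := eqVneq x ozero; [right|left; rewrite gt0_neq].
rewrite -rE => -[[w [wx H]] rmin]; split=> [rz|]; last exact: rmin.
by exists w; split=> // y wy yx Cy; exact: lt_le_trans (H y wy yx Cy) rz.
Qed.

(* The Cantor-Bendixson rank of [x] in [C `|` [set x]], where [C] and the
   point [x] are taken in the order topology of [Ord]. *)
Definition rk (C : set Ord) : Ord -> Ord := projT1 (cid (rk_exists C)).

Lemma rk_leP (C : set Ord) x z :
  rk C x <= z <-> near_below x (fun y => C y -> rk C y < z).
Proof. by rewrite /rk; case: cid. Qed.

(** The [w] that witnesses the rank of [x] also witnesses that points [y] outside [C] have rank at
    most [rk C x]. *)
Lemma rk_near (C : set Ord) x :
  near_below x (fun y => rk C y <= rk C x /\ (C y -> rk C y < rk C x)).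
Proof.
have [w [wx H]] := iffLR (rk_leP C x _) (lexx _).
exists w; split=> // y wy yx; split; last exact: H.
apply/rk_leP; exists w; split=> [|z wz zy]; first by left.
by apply: H => //; exact: lt_trans yx.
Qed.

Lemma rk_unbounded (C : set Ord) x z w : z < rk C x -> w < x ->
  exists y, [/\ w < y, y < x, C y & z <= rk C y].
Proof.
move=> zx wx; apply: contrapT => H; move: zx; rewrite ltNge => /negP; apply.
apply/rk_leP; exists w; split=> [|y wy yx Cy]; first by left.
by rewrite ltNge; apply/negP => zy; apply: H; exists y.
Qed.

Lemma fin_bound k (w : 'I_k -> Ord) x : (forall i, w i < x \/ x = ozero) ->
  exists v, (v < x \/ x = ozero) /\ forall i, w i <= v.
Proof.
move=> wx; exists (\big[Order.max/ozero]_(i < k) w i); split=> [|i]; last exact: le_bigmax.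
have [->|x0] := eqVneq x ozero; [by right|left].
apply: bigmax_lt => [|i _]; first by rewrite gt0_neq.
by case: (wx i) => // /eqP; rewrite (negbTE x0).
Qed.

(** Just below [x], no relative rank exceeds its value at [x], and the one for a set containing [y]
    is strictly smaller; the natural sum is strictly monotone. *)
Lemma rk_setT_le k (C : 'I_k -> set Ord) p :
    (forall y, y < p -> exists i, C i y) ->
  forall x, x <= p -> rk setT x <= \big[natural_sum/ozero]_(i < k) rk (C i) x.
Proof.
move=> Cp; elim/olt_ind => x IH xp.
have [w wP] := choice (fun i : 'I_k => rk_near (C i) x).
have [v [vx wv]] := fin_bound (fun i => (wP i).1).
apply/rk_leP; exists v; split=> // y vy yx _.
have yp := lt_le_trans yx xp.
apply: le_lt_trans (IH y yx (ltW yp)) _; apply: big_natural_sum_lt => [i|].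
  by have [|//] := (wP i).2 y _ yx; exact: le_lt_trans vy.
have [i Cy] := Cp y yp; exists i.
by have [|_ ->//] := (wP i).2 y _ yx; exact: le_lt_trans vy.
Qed.

(** If the rank [r] were below [a], points ending in [wpow r] would be cofinal below the end point
    and have rank at least [r] by induction. *)
Lemma le_rk_wpow x a : a <= rk setT (oadd x (wpow a)).
Proof.
elim/olt_ind: a x => a IH x; rewrite leNgt; apply/negP => ra.
have xa : x < oadd x (wpow a) by rewrite -{1}[x]oadd0 olt_add2l wpow_gt0.
have [w [[wx|x0] H]] := rk_near setT (oadd x (wpow a)); last first.
  by rewrite x0 nlt0 in xa.
(* The maximum puts the new point beyond [w] while keeping it of the form [oadd x _]. *)
have /oadd_sub[u vE] : x <= Order.max w x by rewrite le_max lexx orbT.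
have ua : u < wpow a by rewrite -(olt_add2l x) -vE gt_max wx.
set r := rk _ (oadd x _) in ra H.
have ura : oadd u (wpow r) < wpow a by apply: oadd_wpow_lt => //; exact: lt_wpow.
have [||_ /(_ I)] := H (oadd x (oadd u (wpow r))).
- rewrite oaddA -vE; apply: (@le_lt_trans _ _ (Order.max w x)).
    by rewrite le_max lexx.
  by rewrite -{1}[Order.max w x]oadd0 olt_add2l wpow_gt0.
- by rewrite olt_add2l.
by rewrite oaddA ltNge => /negP; apply; exact: IH.
Qed.

(** Such a [y] lies in a block from [u] (excluded) to [oadd u (wpow e)] (included) with [e < a].
    Inner points of the block have rank below [e] by induction, so its end point has rank at most
    [e]. *)
Lemma rk_wpow_lt a x y : x < y -> y < oadd x (wpow a) -> rk setT y < a.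
Proof.
elim/olt_ind: a x y => a IH x y xy yxa.
have /oadd_sub[z yE] := ltW xy.
have {yxa} za : z < wpow a by rewrite -(olt_add2l x) -yE.
have z0 : ozero < z by rewrite -(olt_add2l x) -yE oadd0.
have a0 : a != ozero.
  by apply: contraTneq za => ->; rewrite wpow0 lt_osuccE -ltNge.
have [e [n [ea zn]]] := lt_wpowE a0 za.
suff [u [uy yu]] : exists u, u < y /\ y <= oadd u (wpow e).
  apply: (le_lt_trans _ ea); move: yu; rewrite le_eqVlt => /orP[/eqP->|yu].
    apply/rk_leP; exists u; split=> [|v uv vu _].
      by left; rewrite -{1}[u]oadd0 olt_add2l wpow_gt0.
    exact: (IH e ea u).
  exact/ltW/(IH e ea u).
elim: n zn => [|n IHn]; first by rewrite omuln0 nlt0.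
rewrite omulnS => zn; have [nz|] := ltP (omuln (wpow e) n) z.
  exists (oadd x (omuln (wpow e) n)); rewrite yE olt_add2l -oaddA ole_add2l.
  by split=> //; exact: ltW.
(* A multiple of [wpow e] is the right end of the block before it; that block exists because [z] is
   positive. *)
rewrite le_eqVlt => /orP[/eqP zE|]; last exact: IHn.
case: n {IHn zn} zE => [zE|n zE]; first by rewrite zE omuln0 ltxx in z0.
exists (oadd x (omuln (wpow e) n)); rewrite yE zE -oaddA -omulnS lexx.
by rewrite olt_add2l omulnS -{1}[omuln _ n]oadd0 olt_add2l wpow_gt0.
Qed.

Lemma rk_omuln_wpow_ge a n x : x < omuln (wpow a) n -> a <= rk setT x ->
  exists m, (m < n)%N /\ x = omuln (wpow a) m.
Proof.
move=> /omuln_div[m [r [mn ra xE]]] ax; exists m; split=> //.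
have [r0|r0] := eqVneq r ozero; first by rewrite xE r0 oadd0.
have : rk setT x < a.
  apply: (@rk_wpow_lt _ (omuln (wpow a) m)); rewrite xE ?olt_add2l //.
  by rewrite -{1}[omuln _ m]oadd0 olt_add2l gt0_neq.
by rewrite ltNge ax.
Qed.

(** * Countable ordinals *)

Lemma countable_lt_omega1 (T : Type) (D : set T) (F : T -> Ord) d :
    countable D -> (forall t, D t -> F t < omega1) ->
    (forall x, x < d -> exists2 t, D t & x < F t) ->
  d < omega1.
Proof.
move=> cD Fw dF; apply/omega1P.
have cU : countable (\bigcup_(t in D) [set x | x < F t]).
  by apply: bigcup_countable => // t /Fw/omega1P.
by apply: sub_countable cU; apply: subset_card_le => x /dF[t Dt xt]; exists t.
Qed.

Lemma osucc_lt_omega1 a : a < omega1 -> osucc a < omega1.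
Proof.
move=> /omega1P ca; apply/omega1P.
have cU : countable (\bigcup_(t in [set: bool]) if t then [set b | b < a] else [set a]).
  by apply: bigcup_countable => // -[].
apply: sub_countable cU; apply: subset_card_le => b /=.
by rewrite lt_osuccE le_eqVlt => /orP[/eqP->|ba]; [exists false|exists true].
Qed.

(** Serves addition, multiplication and powers at once. *)
Lemma ord_rec_lt_omega1 (z : Ord) (s : Ord -> Ord) b :
    z < omega1 -> (forall c, c < omega1 -> s c < omega1) -> b < omega1 ->
  ord_rec z s b < omega1.
Proof.
move=> zw sw; elim/olt_ind: b => b IH bw.
have [->|[d bE]|lb] := ord_cases b; first by rewrite ord_rec_zero.
  rewrite bE ord_rec_succ; apply/sw/IH; first by rewrite bE lt_osucc.
  by apply: lt_trans bw; rewrite bE lt_osucc.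
rewrite ord_rec_lim //; apply: (@countable_lt_omega1 _ [set c | c < b] (ord_rec z s)).
- exact/omega1P.
- by move=> c /= cb; apply: IH => //; exact: lt_trans bw.
- move=> x xs; apply: contrapT => H; move: xs; rewrite ltNge => /negP; apply.
  apply/osup_image_le => c cb; rewrite leNgt; apply/negP => xc.
  by apply: H; exists c.
Qed.

Lemma ozero_lt_omega1 : ozero < omega1.
Proof.
apply/omega1P; suff -> : [set b : Ord | b < ozero] = set0 by [].
by apply/seteqP; split=> b //=; rewrite nlt0.
Qed.

Lemma omega_lt_omega1 : omega < omega1.
Proof.
apply: (@countable_lt_omega1 nat setT ofnat) => // [n _|x /lt_omega[n ->]].
  by elim: n => [|n]; [exact: ozero_lt_omega1|exact: osucc_lt_omega1].
by exists n.+1 => //; exact: lt_osucc.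
Qed.

Lemma wpow_lt_omega1 a : a < omega1 -> wpow a < omega1.
Proof.
apply: ord_rec_lt_omega1 => [|c cw]; first exact/osucc_lt_omega1/ozero_lt_omega1.
apply: ord_rec_lt_omega1 omega_lt_omega1; first exact: ozero_lt_omega1.
move=> d dw; apply: ord_rec_lt_omega1 => //; exact: osucc_lt_omega1.
Qed.

Lemma natural_sum_lt_omega1 a b : a < omega1 -> b < omega1 ->
  natural_sum a b < omega1.
Proof.
rewrite natural_sumE; elim/olt_ind: a b => a IHa; elim/olt_ind => b IHb aw bw.
(* [F] merges the two families of lower bounds in Hessenberg's recursion into one countable family,
   with [ozero] as filler. *)
pose F x := Order.max (if x < a then osucc (hess x b) else ozero)
                      (if x < b then osucc (hess a x) else ozero).
have mw : Order.max a b < omega1 by rewrite gt_max aw.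
apply: (@countable_lt_omega1 _ [set x | x < Order.max a b] F).
- exact/omega1P.
- move=> x _; rewrite /F gt_max; apply/andP; split; case: ifP => [x_lt|_];
    rewrite ?ozero_lt_omega1 //; apply: osucc_lt_omega1.
    by apply: IHa => //; exact: lt_trans aw.
  by apply: IHb => //; exact: lt_trans bw.
- move=> x xh; apply: contrapT => H; move: xh; rewrite ltNge => /negP; apply.
  apply/hess_leP; split=> y y_lt; rewrite ltNge; apply/negP => xy; apply: H;
    by exists y; rewrite /= ?/F lt_max y_lt ?lt_osuccE ?xy ?orbT.
Qed.

Lemma big_natural_sum_lt_omega1 k (a : 'I_k -> Ord) : (forall i, a i < omega1) ->
  \big[natural_sum/ozero]_(i < k) a i < omega1.
Proof.
move=> aw; apply: (big_ind (fun x => x < omega1)) => //.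
  exact: ozero_lt_omega1.
exact: natural_sum_lt_omega1.
Qed.

Lemma enum_lt a : a < omega1 -> a != ozero ->
  exists e : nat -> Ord, (forall n, e n < a) /\ forall x, x < a -> exists n, e n = x.
Proof.
move=> /omega1P/countable_injP[f finj] a0.
pose e n := xget ozero [set x | x < a /\ f x = n].
have eP n : e n < a.
  by rewrite /e; case: xgetP => [x _ []//|_]; rewrite gt0_neq.
exists e; split=> // x xa; exists (f x).
have [ea fe] : e (f x) < a /\ f (e (f x)) = f x.
  by apply: (@xgetPex _ ozero [set y | y < a /\ f y = f x]); exists x.
by apply: finj fe; apply/mem_set.
Qed.

(** Running maxima of an enumeration; taking maxima turns hitting [x] once into staying above it. *)
Lemma enum_cofinal a : a < omega1 -> a != ozero ->
  exists e : nat -> Ord, (forall n, e n < a) /\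
    forall x, x < a -> exists n, forall m, (n <= m)%N -> x <= e m.
Proof.
move=> aw a0; have [e [ea eon]] := enum_lt aw a0.
exists (fun n => \big[Order.max/ozero]_(i < n.+1) e i); split=> [n|x xa].
  by apply: bigmax_lt => [|i _]; rewrite ?gt0_neq.
have [n <-] := eon x xa; exists n => m nm.
by have := @le_bigmax _ _ _ ozero (fun i : 'I_m.+1 => e i) (Ordinal (nm : (n < m.+1)%N)).
Qed.

(** * Copies of powers of omega *)

(** A strictly increasing map from the open interval between [u] and [v] into the part of [C] above
    [w]; the last clause is continuity from the left. *)
Definition normal_into (C : set Ord) w u v (f : Ord -> Ord) :=
  [/\ forall y, u < y -> y < v -> C (f y) /\ w < f y,
      forall y z, u < y -> y < z -> z < v -> f y < f z &
      forall y z, u < y -> y < v -> z < f y ->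
        exists t, [/\ u <= t, t < y & forall y', t < y' -> y' <= y -> z < f y']].

(** The values stay below [x] and converge to [x]; surjectivity is not meant. *)
Definition normal_onto (C : set Ord) w u v x (f : Ord -> Ord) :=
  [/\ normal_into C w u v f,
      forall y, u < y -> y < v -> f y < x &
      forall z, z < x -> exists t,
        [/\ u <= t, t < v & forall y, t < y -> y < v -> z < f y]].

(** Each piece excludes its left end and includes its right end, where it takes the value [X n.+1].
    Left-continuity can thus be checked inside a single piece. *)
Lemma normal_glue (C : set Ord) (s X : nat -> Ord) (f : nat -> Ord -> Ord) v x :
    (forall n, s n < s n.+1) -> (forall n, s n < v) ->
    (forall y, y < v -> exists n, y <= s n) ->
    (forall n, X n < x) -> (forall z, z < x -> exists n, z <= X n) ->
    (forall n, normal_into C (X n) (s n) (osucc (s n.+1)) (f n)) ->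
    (forall n, f n (s n.+1) = X n.+1) ->
  exists F, normal_onto C (X 0%N) (s 0%N) v x F.
Proof.
move=> sS sv scof Xx Xcof fN fS.
have XS n : X n < X n.+1.
  by have [/(_ (s n.+1) (sS n) (lt_osucc _))[_ +] _ _] := fN n; rewrite fS.
have s_le : {homo s : m n / (m <= n)%N >-> m <= n}.
  by apply: homo_leq => [z|z y t|n]; [exact: lexx|exact: le_trans|exact: ltW].
have X_le : {homo X : m n / (m <= n)%N >-> m <= n}.
  by apply: homo_leq => [z|z y t|n]; [exact: lexx|exact: le_trans|exact: ltW].
have seg y : s 0%N < y -> y < v -> exists n, s n < y <= s n.+1.
  move=> s0y /scof yn; case: (ex_minnP yn) => -[|n] yn1 nmin.
    by have := lt_le_trans s0y yn1; rewrite ltxx.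
  exists n; rewrite yn1 andbT ltNge; apply/negP => /nmin.
  by rewrite ltnn.
have segI m n y : s m < y -> y <= s n.+1 -> (m <= n)%N.
  by move=> my yn; rewrite leqNgt; apply/negP => /s_le /(le_trans yn); rewrite leNgt my.
(* The index of the piece containing [y]; it is unique by [segI]. *)
pose N y := xget 0%N [set n | s n < y <= s n.+1].
pose F y := f (N y) y.
have FE n y : s n < y -> y <= s n.+1 -> F y = f n y.
  move=> ny yn; have /andP[my ym] : s (N y) < y <= s (N y).+1.
    by apply: (@xgetPex _ 0%N [set n | s n < y <= s n.+1]); exists n; rewrite /= ny.
  by rewrite /F; congr f; apply/anti_leq; rewrite (segI _ _ _ my yn) (segI _ _ _ ny ym).
have F_le n y : s n < y -> y <= s n.+1 -> F y <= X n.+1.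
  move=> ny yn; rewrite (FE _ _ ny yn) -fS.
  move: yn; rewrite le_eqVlt => /orP[/eqP->//|yn].
  by have [_ fm _] := fN n; apply/ltW/fm => //; rewrite lt_osucc.
have F_gt n y : s n < y -> y < v -> X n < F y.
  move=> ny yv; have [m /andP[my ym]] := seg y (le_lt_trans (s_le _ _ (leq0n n)) ny) yv.
  rewrite (FE _ _ my ym); apply: (@le_lt_trans _ _ (X m)).
    by apply/X_le/(segI _ _ _ ny ym).
  by have [/(_ y my)[]] := fN m; rewrite ?lt_osuccE.
exists F; split=> [|y uy yv|z zx]; last 2 first.
- have [n /andP[ny yn]] := seg y uy yv; exact: le_lt_trans (F_le n y ny yn) (Xx _).
- have [n zn] := Xcof z zx; exists (s n); split=> // [|y ny yv]; first exact: s_le.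
  exact: le_lt_trans zn (F_gt n y ny yv).
split=> [y uy yv|y z uy yz zv|y z uy yv zy].
- have [n /andP[ny yn]] := seg y uy yv.
  split; last by apply: le_lt_trans (F_gt n y ny yv); exact: X_le.
  by have [/(_ y ny)[]] := fN n; rewrite ?lt_osuccE // (FE _ _ ny yn).
- have [n /andP[ny yn]] := seg y uy (lt_trans yz zv).
  have [zn|nz] := leP z (s n.+1).
    rewrite (FE _ _ ny yn) (FE _ _ (lt_trans ny yz) zn).
    by have [_ fm _] := fN n; apply: fm => //; rewrite lt_osuccE.
  exact: le_lt_trans (F_le n y ny yn) (F_gt _ _ nz zv).
- have [n /andP[ny yn]] := seg y uy yv.
  rewrite (FE _ _ ny yn) in zy.
  have [_ _ /(_ y z ny)] := fN n; rewrite lt_osuccE => /(_ yn zy)[t [nt ty tP]].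
  exists t; split=> // [|y' ty' y'y]; first exact: le_trans (s_le _ _ (leq0n n)) nt.
  by rewrite (FE n) ?tP // ?(le_trans y'y) // (le_lt_trans nt).
Qed.

(** Sending [v] to [x] extends the map; left-continuity at [v] is the convergence to [x]. *)
Lemma normal_close (C : set Ord) w u v x (F : Ord -> Ord) :
    C x -> w < x -> normal_onto C w u v x F ->
  exists f, normal_into C w u (osucc v) f /\ f v = x.
Proof.
move=> Cx wx [[FC Fm Fc] Fx Fcof].
pose f y := if y == v then x else F y.
have fE y : y < v -> f y = F y by rewrite /f lt_neqAle => /andP[/negPf->].
have fv : f v = x by rewrite /f eqxx.
exists f; split=> //; split=> [y uy|y z uy yz|y z uy].
- rewrite lt_osuccE le_eqVlt => /orP[/eqP->|yv]; first by rewrite fv.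
  by rewrite fE //; exact: FC.
- rewrite lt_osuccE => zv; rewrite (fE _ (lt_le_trans yz zv)).
  move: zv; rewrite le_eqVlt => /orP[/eqP zv|zv]; last by rewrite fE //; exact: Fm.
  by rewrite zv fv; apply: Fx; rewrite // -zv.
- rewrite lt_osuccE le_eqVlt => /orP[/eqP->|yv].
    rewrite fv => zx; have [t [ut tv tP]] := Fcof z zx.
    exists t; split=> // y' ty'; rewrite le_eqVlt => /orP[/eqP->|y'v].
      by rewrite fv.
    by rewrite fE // tP.
  rewrite fE // => zy; have [t [ut ty tP]] := Fc y z uy yv zy.
  exists t; split=> // y' ty' y'y.
  by rewrite fE ?tP // (le_lt_trans y'y).
Qed.

(* Every exponent below [a] is eventually dominated by [e n], so the sum of
   the [wpow (e n)] is [wpow a]. *)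
Lemma wpow_partial_sums a u : a < omega1 -> a != ozero ->
  exists e s : nat -> Ord, [/\ s 0%N = u, forall n, e n < a,
    forall n, s n.+1 = oadd (s n) (wpow (e n)), forall n, s n < oadd u (wpow a) &
    forall y, y < oadd u (wpow a) -> exists n, y <= s n].
Proof.
move=> aw a0; have [e [ea ecof]] := enum_cofinal aw a0.
pose s := fix s n := if n is m.+1 then oadd (s m) (wpow (e m)) else u.
exists e, s; split=> // [n|y].
  suff [t ta ->] : exists2 t, t < wpow a & s n = oadd u t by rewrite olt_add2l.
  elim: n => [|n [t ta sE]]; first by exists ozero; rewrite ?wpow_gt0 ?oadd0.
  exists (oadd t (wpow (e n))); last by rewrite /= sE oaddA.
  by apply: oadd_wpow_lt => //; exact: lt_wpow.
have [yu _|/ltW/oadd_sub[z ->]] := leP y u; first by exists 0%N.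
rewrite olt_add2l => /(lt_wpowE a0)[b [m [/ecof[N bN] /ltW zm]]].
exists (N + m)%N; apply: le_trans (_ : oadd u (omuln (wpow b) m) <= _).
  by rewrite ole_add2l.
elim: m {zm} => [|m IH].
  rewrite omuln0 oadd0; elim: (N + 0)%N => // n IH.
  exact: le_trans IH (le_oaddr _ _).
by rewrite omulnS oaddA addnS /=; apply: ole_add => //; apply/le_wpow/bN/leq_addr.
Qed.

Lemma rank_sequence (C : set Ord) a x w (e : nat -> Ord) :
    x < omega1 -> a <= rk C x -> w < x -> (forall n, e n < a) ->
  exists X : nat -> Ord, [/\ X 0%N = w, forall n, X n < x,
    forall n, [/\ X n < X n.+1, C (X n.+1) & e n <= rk C (X n.+1)] &
    forall z, z < x -> exists n, z <= X n].
Proof.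
move=> xw ax wx ea.
have x0 : x != ozero by rewrite -gt0_neq; exact: le_lt_trans (ozero_le w) wx.
have [d [dx donto]] := enum_lt xw x0.
(* One step from the point [p.2] at stage [p.1]: passing [d p.1] makes the sequence cofinal in [x],
   and [rk_unbounded] supplies the rank. *)
have /choice[nx nxP] (p : nat * Ord) : exists y, p.2 < x ->
    [/\ y < x, p.2 < y, d p.1 < y, C y & e p.1 <= rk C y].
  case: p => n y /=; have [yx|] := boolP (y < x); last by exists y.
  have [||z [+ zx Cz ez]] := @rk_unbounded C x (e n) (Order.max y (d n)).
  - exact: lt_le_trans ax.
  - by rewrite gt_max yx dx.
  by rewrite gt_max => /andP[yz dz]; exists z.
pose X := fix X n := if n is m.+1 then nx (m, X m) else w.
have Xx n : X n < x by elim: n => // n /(nxP (n, _))[].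
exists X; split=> // [n|z /donto[n <-]].
  by have [_ ? _ ? ?] := nxP (n, X n) (Xx n).
by exists n.+1; have [_ _ ? _ _] := nxP (n, X n) (Xx n); exact: ltW.
Qed.

(** Points of [C] with ranks at least [e n] converge to [x]; closed copies of [wpow (e n)] ending at
    these points are glued into an open copy of [wpow a]. The point [x] is added only if it lies in
    [C]. *)
Lemma normal_exists (C : set Ord) a u w x :
    a < omega1 -> x < omega1 -> a <= rk C x -> w < x ->
  (a != ozero -> exists F, normal_onto C w u (oadd u (wpow a)) x F) /\
  (C x -> exists f, normal_into C w u (osucc (oadd u (wpow a))) f /\
    f (oadd u (wpow a)) = x).
Proof.
elim/olt_ind: a u w x => a IH u w x aw xw ax wx.
have [a0|a0] := eqVneq a ozero.
  (* For [a = ozero] the domain is the single point [osucc u]. *)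
  split=> // Cx; exists (fun=> x); split=> //.
  rewrite a0 wpow0 oaddS oadd0; split=> [//|y z uy yz|y z uy yv zx].
    rewrite !lt_osuccE => /(lt_le_trans yz) yu.
    by rewrite -osucc_le in uy; have := lt_le_trans yu uy; rewrite ltxx.
  by exists u; split.
suff open_case : exists F, normal_onto C w u (oadd u (wpow a)) x F.
  by split=> // Cx; have [F /(normal_close Cx wx)] := open_case.
have [e [s [s0 ea sS sv scof]]] := wpow_partial_sums u aw a0.
have [X [X0 Xx XS Xcof]] := rank_sequence xw ax wx ea.
have /choice[f fP] n : exists f,
    normal_into C (X n) (s n) (osucc (s n.+1)) f /\ f (s n.+1) = X n.+1.
  have [XX CX eX] := XS n; rewrite sS.
  have [] := IH _ (ea n) (s n) (X n) (X n.+1) _ _ eX XX => //; first exact: lt_trans aw.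
    exact: lt_trans xw.
  by move=> _; apply.
have ss n : s n < s n.+1 by rewrite sS -{1}[s n]oadd0 olt_add2l wpow_gt0.
have := normal_glue ss sv scof Xx Xcof (fun n => (fP n).1) (fun n => (fP n).2).
by rewrite X0 s0.
Qed.

(** * The order topology *)

Lemma nbhs_below p (u : below p) (U : set (below p)) : nbhs u U ->
  exists w, (w < val u \/ val u = ozero) /\
    forall v : below p, (w < val v \/ v = u) -> val v <= val u -> U v.
Proof.
rewrite itv_nbhsE => -[[l r] [oi /=]]; rewrite itv_boundlr => /andP[lu ur] iU.
have r_ok (v : below p) : val v <= val u -> (BRight v <= r)%O.
  by move=> vu; apply: le_trans ur; rewrite bnd_simp leEsub.
case: l oi lu iU => [b t|b] oi lu iU; last first.
  exists ozero; split=> [|v _ /r_ok vr].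
    by have [->|] := eqVneq (val u) ozero; [right|rewrite -gt0_neq; left].
  by apply: iU; rewrite /= itv_boundlr vr; case: b oi lu.
case: b oi lu iU => oi lu iU; first by case: r oi {ur iU r_ok} => [[]|[]].
exists (val t); split=> [|v tv /r_ok vr].
  by left; move: lu; rewrite bnd_simp ltEsub.
apply: iU; rewrite /= itv_boundlr vr andbT.
by case: tv => [|->//]; rewrite bnd_simp ltEsub.
Qed.

(** This set is the open ray below the successor of [u], or the whole space if that successor is not
    below [p]. *)
Lemma nbhs_below_le p (u : below p) : nbhs u [set v : below p | val v <= val u].
Proof.
have [up|pu] := ltP (osucc (val u)) p; last first.
  apply: filterS filterT => v _ /=.
  by rewrite -lt_osuccE; apply: lt_le_trans pu; exact: (valP v).
apply: open_nbhs_nbhs; split; last exact: lexx.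
have -> : [set v : below p | val v <= val u] =
    [set` `]-oo, (exist _ (osucc (val u)) up : below p)[ ].
  by apply/seteqP; split=> v; rewrite /= in_itv /= ltEsub /= lt_osuccE.
exact: lray_open.
Qed.

Lemma nbhs_below_gt p (u : below p) w : w < val u ->
  nbhs u [set v : below p | w < val v].
Proof.
move=> wu; have wp : w < p := lt_trans wu (valP u).
apply: open_nbhs_nbhs; split; last by [].
have -> : [set v : below p | w < val v] = [set` `](exist _ w wp : below p), +oo[ ].
  by apply/seteqP; split=> v; rewrite /= in_itv /= andbT ltEsub.
exact: rray_open.
Qed.

Lemma below_inj p (u v : below p) : val u = val v -> u = v.
Proof. exact: val_inj. Qed.

(** Neighbourhoods are decided from the left. Left-continuity makes [f] continuous; strict
    monotonicity alone makes its inverse continuous. *)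
Lemma normal_homeomorphic p q (f : below p -> below q) :
    (forall u v, val u < val v -> val (f u) < val (f v)) ->
    (forall u z, z < val (f u) -> exists t, (t < val u \/ val u = ozero) /\
      forall v, t < val v -> val v <= val u -> z < val (f v)) ->
  homeomorphic (range f) (below p).
Proof.
move=> fm fc.
have f_lt u v : val (f u) < val (f v) -> val u < val v.
  case: (ltP (val u) (val v)) => // + fuv; rewrite le_eqVlt => /orP[/eqP vu|/fm vu].
    by rewrite (below_inj vu) ltxx in fuv.
  by have := lt_trans fuv vu; rewrite ltxx.
have f_le u v : val (f u) <= val (f v) -> val u <= val v.
  by rewrite !leNgt; apply: contra; exact: fm.
have f_inj : injective f.
  by move=> u v fuv; apply/below_inj/le_anti; rewrite !f_le ?fuv.
pose g (u : below p) : range f := exist _ (f u) (mem_set (imageT f u)).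
have /choice[h hP] (v : range f) : exists u, f u = set_val v.
  by have [u _ fu] := set_valP v; exists u.
have gK : cancel g h by move=> u; apply: f_inj; rewrite hP.
have hK : cancel h g by move=> v; apply: val_inj; rewrite /= hP.
exists h, g; split=> //.
  move=> v; rewrite -(hK v); move: (h v) => u U.
  rewrite gK => /nbhs_below[w [wu wU]].
  suff : nbhs (set_val (g u)) [set v' : below q | forall u', f u' = v' ->
      (w < val u' \/ u' = u) /\ val u' <= val u].
    move=> H0; have := @initial_continuous _ _ set_val (g u) _ H0.
    apply: (@filterS _ (nbhs (g u))) => v' /= H.
    by have [Hw Hu] := H (h v') (hP v'); exact: wU.
  have := nbhs_below_le (f u); case: wu => [wu|u0].
    (* The points of the range above [f w'] and up to [f u] come from points above [w] and up to
       [u]. *)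
    pose w' : below p := exist _ w (lt_trans wu (valP u)).
    have /nbhs_below_gt : val (f w') < val (f u) by exact: fm.
    apply: filterS2 => v' /= wv' v'u u' u'E; rewrite -u'E in wv' v'u.
    by split; [left; exact: (f_lt w')|exact: f_le].
  apply: filterS => v' /= v'u u' u'E; rewrite -u'E in v'u.
  have u'u := f_le _ _ v'u; split=> //; right; apply/below_inj/le_anti.
  by rewrite u'u u0 ozero_le.
apply: continuous_comp_initial => u U /nbhs_below[w [wu wU]].
have f_homo v : val v <= val u -> val (f v) <= val (f u).
  by rewrite le_eqVlt => /orP[/eqP/below_inj->//|/fm/ltW].
suff : nbhs u [set v | w < val (f v) \/ f v = f u].
  apply: filterS2 (nbhs_below_le u) => v /= /f_homo vu wv; exact: wU.
case: wu => [/fc[t [tu tP]]|fu0]; last first.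
  apply: filterS (nbhs_below_le u) => v /= /f_homo vu; right.
  by apply/below_inj/le_anti; rewrite vu /= [X in X <= _]fu0 ozero_le.
case: tu => [/nbhs_below_gt|u0].
  apply: filterS2 (nbhs_below_le u) => v /= vu tv; left; exact: tP.
apply: filterS (nbhs_below_le u) => v /= vu; right; congr f.
by apply/below_inj/le_anti; rewrite vu u0 ozero_le.
Qed.

(** * The pigeonhole principle *)

(** Points [v] just below [u] are mapped just below [h u], by continuity and injectivity, hence to
    smaller ranks in [C]. As [s] is increasing there, it bounds the rank of [u] by induction. *)
Lemma rk_preimage_le p q (h : below p -> below q) g (C : set Ord) (s : Ord -> Ord) :
    continuous h -> injective h ->
    (forall x y, C x -> C y -> x < y -> y < g -> s x < s y) ->
    (forall u, rk setT (val (h u)) < g -> C (rk setT (val (h u)))) ->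
  forall u, rk setT (val (h u)) < g -> rk setT (val u) <= s (rk setT (val (h u))).
Proof.
move=> hc h_inj sm hC u; move Ex : (val u) => x.
elim/olt_ind: x u Ex => x IH u ux hg; subst x.
have [w [wu wP]] := rk_near setT (val (h u)).
have : nbhs u (h @^-1` [set v | (w < val v \/ val (h u) = ozero) /\ val v <= val (h u)]).
  apply: hc; case: wu => [wu|hu0].
    apply: filterS2 (nbhs_below_le (h u)) (nbhs_below_gt wu) => v vu wv.
    by split; first left.
  by apply: filterS (nbhs_below_le (h u)) => v vu; split; first right.
move=> /nbhs_below[t [tu tP]]; apply/rk_leP; exists t; split=> // y ty yu _.
have yp : y < p := lt_trans yu (valP u).
pose v : below p := exist _ y yp.
have [wv hvu] := tP v (or_introl ty) (ltW yu).
have {}hvu : val (h v) < val (h u).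
  rewrite lt_neqAle hvu andbT; apply/eqP => /below_inj/h_inj vu.
  by move: yu; rewrite -vu ltxx.
have {}wv : w < val (h v).
  by case: wv => // hu0; move: hvu; rewrite hu0 nlt0.
have [_ /(_ I) rvu] := wP _ wv hvu.
have rv := lt_trans rvu hg.
exact: le_lt_trans (IH y yu v erefl rv) (sm _ _ (hC _ rv) (hC _ hg) rvu hg).
Qed.

(** Only the finitely many multiples of [wpow g] below [q] can have rank at least [g], and each has
    at most one preimage; [w] is chosen past these preimages. *)
Lemma rk_eventually_lt a g n q (h : below (wpow a) -> below q) :
    injective h -> q <= omuln (wpow g) n ->
  exists w, w < wpow a /\ forall u, w < val u -> rk setT (val (h u)) < g.
Proof.
move=> h_inj qn.
have [w [wa wP]] : exists w, w < wpow a /\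
    forall u m, w < val u -> (m < n)%N -> val (h u) <> omuln (wpow g) m.
  elim: {qn} n => [|n [w [wa wP]]]; first by exists ozero; split=> //; exact: wpow_gt0.
  have [[u0 hu0]|nu0] := pselect (exists u0, val (h u0) = omuln (wpow g) n).
    exists (Order.max w (val u0)); split=> [|u m].
      by rewrite gt_max wa; exact: (valP u0).
    rewrite gt_max => /andP[wu u0u]; rewrite ltnS leq_eqVlt => /orP[/eqP->|]; last exact: wP.
    by rewrite -hu0 => /below_inj/h_inj uE; rewrite uE ltxx in u0u.
  exists w; split=> // u m wu; rewrite ltnS leq_eqVlt => /orP[/eqP->|]; last exact: wP.
  by move=> hu; apply: nu0; exists u.
exists w; split=> // u wu; rewrite ltNge; apply/negP => gu.
have [m [mn hm]] := rk_omuln_wpow_ge (lt_le_trans (valP (h u)) qn) gu.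
exact: wP hm.
Qed.

(** * Milner-Rado sums and the two bounds *)

Definition has_pigeonhole (k : nat) (alpha : 'I_k -> Ord) : set Ord := [set b |
  forall c : below b -> 'I_k, exists (i : 'I_k) (X : set (below b)),
    X `<=` c @^-1` [set i] /\ homeomorphic X (below (alpha i))].

Definition small_sum (k : nat) (alpha : 'I_k -> Ord) : set Ord := [set d |
  exists a : 'I_k -> Ord, (forall i, a i < alpha i) /\
    d = \big[natural_sum/ozero]_(i < k) a i].

(** For positive [k], strict monotonicity keeps the full sum of the [alpha i] from being a small
    sum, so [least] is taken over a nonempty set. *)
Lemma milner_rado_sumP (k : nat) (alpha : 'I_k -> Ord) : (0 < k)%N ->
  [/\ ~ small_sum alpha (milner_rado_sum alpha),
      forall d, d < milner_rado_sum alpha -> small_sum alpha d &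
      milner_rado_sum alpha <= \big[natural_sum/ozero]_(i < k) alpha i].
Proof.
move=> k_gt0; set D := [set d | forall a : 'I_k -> Ord, (forall i, a i < alpha i) ->
    d <> \big[natural_sum/ozero]_(i < k) a i].
have Dsum : D (\big[natural_sum/ozero]_(i < k) alpha i).
  move=> a aal sumE; suff : \big[natural_sum/ozero]_(i < k) a i <
      \big[natural_sum/ozero]_(i < k) alpha i by rewrite -sumE ltxx.
  apply: big_natural_sum_lt => [i|]; first exact: ltW.
  by exists (Ordinal k_gt0).
have [Dd dmin] := @leastP D (ex_intro _ _ Dsum); split.
- by move=> [a [aal dE]]; exact: Dd dE.
- move=> d dd; apply: contrapT => H; move: dd; rewrite ltNge => /negP; apply.
  by apply: dmin => a aal dE; apply: H; exists a.
- exact: dmin.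
Qed.

Lemma milner_rado_sum_neq0 (k : nat) (alpha : 'I_k -> Ord) : (0 < k)%N ->
  (forall i, alpha i <> ozero) -> milner_rado_sum alpha != ozero.
Proof.
move=> k_gt0 alpha0; apply/eqP => d0; have [nd _ _] := milner_rado_sumP alpha k_gt0; apply: nd.
exists (fun=> ozero); split=> [i|]; first by rewrite gt0_neq; apply/eqP.
rewrite d0; apply: (big_ind (fun x => ozero = x)) => // x y <- <-.
by rewrite natural_sumE hess00.
Qed.

Lemma pigeonhole_wpow (k : nat) (alpha : 'I_k -> Ord) : (0 < k)%N ->
    (forall i, alpha i < omega1 /\ alpha i <> ozero) ->
  has_pigeonhole (fun i => wpow (alpha i)) (wpow (milner_rado_sum alpha)).
Proof.
move=> k_gt0 alphaP; set delta := milner_rado_sum alpha.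
move=> c; pose C i := [set x | exists2 u, val u = x & c u = i].
have [nd _ dsum] := milner_rado_sumP alpha k_gt0.
have dw : wpow delta < omega1.
  apply/wpow_lt_omega1/(le_lt_trans dsum).
  by apply: big_natural_sum_lt_omega1 => i; exact: (alphaP i).1.
(* Otherwise [delta], being at most the sum of these ranks, would be a sum of ordinals below the
   [alpha i]. *)
have [i ai] : exists i, alpha i <= rk (C i) (wpow delta).
  apply: contrapT => H; apply: nd.
  have [|a [aC dE]] := @big_natural_sum_onto k (fun i => rk (C i) (wpow delta)) delta.
    apply: (@le_trans _ _ (rk setT (wpow delta))).
      by rewrite -[wpow delta]add0o le_rk_wpow.
    apply: (@rk_setT_le k C (wpow delta)) => // y yd.
    by exists (c (exist _ y yd)), (exist _ y yd).
  exists a; split=> // i; apply: le_lt_trans (aC i) _.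
  by rewrite ltNge; apply/negP => ai; apply: H; exists i.
have ai0 : alpha i != ozero by apply/eqP; exact: (alphaP i).2.
(* The open form is the right one: the end point [wpow delta] has no colour. *)
have [/(_ ai0)[F [[FC Fm Fc] _ _]] _] :=
  normal_exists ozero (alphaP i).1 dw ai (wpow_gt0 _).
rewrite add0o in FC Fm Fc.
(* The domain of [F] omits [ozero], so the copy is indexed through the shift from [u] to [1 + u]. *)
have one x : ozero < oadd (osucc ozero) x.
  by apply: lt_le_trans (le_oaddr _ _); exact: lt_osucc.
have one_lt (u : below (wpow (alpha i))) : oadd (osucc ozero) (val u) < wpow (alpha i).
  apply: oadd_wpow_lt (valP u); rewrite -wpow0; apply: lt_wpow.
  by rewrite gt0_neq.
have /choice[f fP] (u : below (wpow (alpha i))) : exists v,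
    val v = F (oadd (osucc ozero) (val u)) /\ c v = i.
  by have [[v vE vi] _] := FC _ (one _) (one_lt u); exists v.
exists i, (range f); split=> [_ [u _ <-]|]; first exact: (fP u).2.
apply: normal_homeomorphic => [u v uv|u z].
  by rewrite !(fP _).1; apply: Fm; rewrite ?olt_add2l.
rewrite (fP u).1 => /(Fc _ _ (one _) (one_lt u))[t [_ tu tP]].
have [t1|/oadd_sub[t' tE]] := ltP t (osucc ozero).
  exists ozero; split=> [|v _ vu].
    by have [->|] := eqVneq (val u) ozero; [right|rewrite -gt0_neq; left].
  rewrite (fP v).1; apply: tP; last by rewrite ole_add2l.
  by apply: lt_le_trans t1 (le_oaddr _ _).
exists t'; split=> [|v t'v vu]; first by left; rewrite -(olt_add2l (osucc ozero)) -tE.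
by rewrite (fP v).1; apply: tP; rewrite ?ole_add2l // tE olt_add2l.
Qed.

Lemma pigeonhole_ge (k : nat) (alpha : 'I_k -> Ord) b : (0 < k)%N ->
    (forall i, alpha i <> ozero) ->
  has_pigeonhole (fun i => wpow (alpha i)) b -> wpow (milner_rado_sum alpha) <= b.
Proof.
move=> k_gt0 alpha0 bP; rewrite leNgt; apply/negP.
move=> /(lt_wpowE (milner_rado_sum_neq0 k_gt0 alpha0))[g [n [gd bn]]].
have [_ /(_ g gd)[a [aal gE]] _] := milner_rado_sumP alpha k_gt0.
have [C [s [Cg sa sm]]] := big_natural_sum_splits a; rewrite -gE in Cg sa sm.
(* Points of rank at least [g] receive an arbitrary colour. *)
have /choice[c cP] (u : below b) : exists i, rk setT (val u) < g -> C i (rk setT (val u)).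
  have [/Cg[i Ci]|gu] := ltP (rk setT (val u)) g; first by exists i.
  by exists (Ordinal k_gt0).
have [i [X [Xi [f [f' [_ f'K _ f'c]]]]]] := bP c.
pose h (u : below (wpow (alpha i))) : below b := set_val (f' u).
have h_inj : injective h by move=> u v /val_inj/(can_inj f'K).
have hc : continuous h.
  by move=> u; apply: continuous_comp; [exact: f'c|exact: initial_continuous].
have hi u : c (h u) = i by apply: Xi; exact: set_valP.
have [w [wa wP]] := rk_eventually_lt h_inj (ltW bn).
have yp : oadd w (wpow (a i)) < wpow (alpha i).
  by apply: oadd_wpow_lt => //; apply: lt_wpow.
(* This point has rank at least [a i], yet [rk_preimage_le] bounds its rank by a value of [s i],
   which is below [a i]. *)
pose u : below (wpow (alpha i)) := exist _ (oadd w (wpow (a i))) yp.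
have hg : rk setT (val (h u)) < g.
  by apply: wP; rewrite /= -{1}[w]oadd0 olt_add2l wpow_gt0.
have hC v : rk setT (val (h v)) < g -> C i (rk setT (val (h v))).
  by move=> /cP; rewrite hi.
have := rk_preimage_le hc h_inj (sm i) hC hg.
rewrite leNgt => /negP; apply; apply: lt_le_trans (le_rk_wpow w (a i)).
exact: sa (hC _ hg) hg.
Qed.

Theorem theorem4p6 (k : nat) (hk : (0 < k)%N) (alpha : 'I_k -> Ord)
    (halpha : forall i : 'I_k, alpha i < omega1 /\ alpha i <> ozero) :
  Ptop (fun i : 'I_k => opow omega (alpha i)) =
    opow omega (milner_rado_sum alpha).
Proof.
apply: least_eq; first exact: pigeonhole_wpow.
by move=> b; apply: pigeonhole_ge => // i; exact: (halpha i).2.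
Qed.
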